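(* For a natural number $k$, let $E(k)$ be the set of $k$-exactly-perfect numbers and $E(k;x)=E(k)\cap[1,x]$. Let $\mathcal{M}$ be the set of natural numbers of the form $2q$ with $q$ prime and $2^q-1$ prime. For $\epsilon\in(0,1/3)$ let $E_\epsilon(k;x)=\{n\le x: n\in E(k),\ \sigma(n)\ge 2n+n^{\epsilon}\}$. Assume there is no odd perfect number. Then for all sufficiently large $k$ with $k\notin\mathcal{M}$, $$\lim_{x\to\infty}\frac{\#E_\epsilon(k;x)}{\#E(k;x)}=1.$$ Moreover, unconditionally this limit equals $1$ for $k=8$, $k=2^{s+2}-4$ ($2\le s\le8$), $k=3\cdot2^s-5$ ($2\le s\le8$), $k=3\cdot2^s-6$ ($3\le s\le8$), and $k=2^{s+2}-7$ ($2\le s\le8$); and for $k=4$ and $k=6$, $$\lim_{x\to\infty}\frac{\#E_\epsilon(k;x)}{\#E(k;x)}=0.$$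
   Context: A natural number $n$ is $k$-exactly-perfect if $n$ equals the sum of all of its proper divisors except for exactly $k$ of them. $\sigma(n)$ is the sum of the positive divisors of $n$. (The paper denotes the set $\mathcal{M}$ by $M$.) *)

(* Defs.v *)
From mathcomp Require Import all_boot all_order all_algebra finmap.
From mathcomp Require Import all_classical all_reals all_analysis.

Set Implicit Arguments.
Unset Strict Implicit.
Unset Printing Implicit Defensive.

Import Order.TTheory GRing.Theory Num.Theory.
Import numFieldNormedType.Exports.

Local Open Scope classical_set_scope.
Local Open Scope ring_scope.

Definition sigma (n : nat) : nat := (\sum_(d <- divisors n) d)%N.

Definition proper_divisors (n : nat) : seq nat :=
  [seq d <- divisors n | (d < n)%N].

Definition perfect (n : nat) : Prop := (0 < n)%N /\ sigma n = (2 * n)%N.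

(* [D] lists the omitted proper divisors.  Natural numbers are positive here:
   since [divisors 0 = [::]], 0 has to be excluded explicitly. *)
Definition exactly_perfect (k n : nat) : Prop :=
  (0 < n)%N /\
  exists D : seq nat,
    [/\ uniq D, {subset D <= proper_divisors n}, size D = k &
        n = (\sum_(d <- proper_divisors n | d \notin D) d)%N].

Definition E (k : nat) : set nat := [set n | exactly_perfect k n].

Definition E_upto (R : realType) (k : nat) (x : R) : set nat :=
  E k `&` [set n : nat | (1 <= n)%N /\ n%:R <= x].

Definition E_eps_upto (R : realType) (eps : R) (k : nat) (x : R) : set nat :=
  [set n | [/\ n%:R <= x, E k n &
               (sigma n)%:R >= 2 * n%:R + n%:R `^ eps]].

Definition M : set nat :=
  [set m | exists q : nat,
     [/\ prime q, prime (2 ^ q - 1)%N & m = (2 * q)%N]].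

(* [fset_set A] is [fset0] when [A] is infinite; both sets below are finite,
   their elements being at most [x]. *)
Definition E_ratio (R : realType) (eps : R) (k : nat) (x : R) : R :=
  #|` fset_set (E_eps_upto eps k x)|%:R / #|` fset_set (E_upto k x)|%:R.

(* Main.v *)
Require Import Defs.
From mathcomp Require Import all_boot all_order all_algebra finmap zify.
From mathcomp Require Import all_classical all_reals all_analysis.
Import Order.TTheory GRing.Theory Num.Theory.
Import numFieldNormedType.Exports.

(** Let [n] be in [E(k)] and let [p] be its largest prime factor. Outside a set of at most
    [x / (log x)^C] integers up to [x], for any [C], one has [n = m * p] with [p] prime to [m],
    and comparing the coefficients of [p] in [sigma m * (p + 1) = (2 * m + A) * p + B], where [A]
    and [B] are sums of divisors of [m], shows that either [p] is determined by [m] and the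
    omitted divisors (which makes [n] rare), or [sigma m = 2 * m + A] and [B = sigma m]. In the
    latter case [m] is in [E(j)] with [j + tau m = k]. Conversely, such an [m] yields
    [m * p] in [E(k)] for every prime [p] not dividing [m], hence at least [c x / log x]
    elements of [E(k)] by Chebyshev's bound.

    If [sigma n < 2 * n + n^eps] then, by induction on [k], up to a sparse set [m] is perfect,
    so that [tau m = k]; Dickson's theorem leaves finitely many such [m]. An even perfect [m]
    forces [k] to be in [M], an odd one forces [tau m = 2] modulo [4]. The remaining values
    [k = 3 * 2^s - 6] are settled by the numbers [28 * c * p * q], which outnumber the primes
    because the sum of the reciprocals of the primes diverges. For [k = 4] and [k = 6] an
    abundant [m] is impossible since it has at least six divisors. *)

Set Implicit Arguments.
Unset Strict Implicit.
Unset Printing Implicit Defensive.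

(** * Multiplicativity of the divisor functions *)

Definition tau (n : nat) : nat := size (divisors n).

Lemma divisors_coprimeM a b : 0 < a -> 0 < b -> coprime a b ->
  perm_eq (divisors (a * b)) [seq x * y | x <- divisors a, y <- divisors b].
Proof.
move=> a0 b0 cab; have ab0 : 0 < a * b by rewrite muln_gt0 a0.
(* The gcds with [a] and with [b] recover the two factors, so the product map is injective. *)
have gcdl x y : x %| a -> y %| b -> gcdn a (x * y) = x.
  move=> xa yb; rewrite Gauss_gcdl; first exact/gcdn_idPr.
  by apply: coprime_dvdr yb _.
have gcdr x y : x %| a -> y %| b -> gcdn b (x * y) = y.
  move=> xa yb; rewrite Gauss_gcdr; first exact/gcdn_idPr.
  by rewrite coprime_sym; apply: coprime_dvdl xa _.
apply: uniq_perm; first exact: divisors_uniq.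
  apply: allpairs_uniq; [exact: divisors_uniq..|].
  move=> [x y] [x' y'] /allpairsP[[x1 y1] /= [+ + [-> ->]]] /allpairsP[[x2 y2] /= [+ + [-> ->]]] /=.
  rewrite -!dvdn_divisors // => h1 h2 h3 h4 e.
  by congr pair; [rewrite -(gcdl _ _ h1 h2) e gcdl | rewrite -(gcdr _ _ h1 h2) e gcdr].
move=> d; rewrite -dvdn_divisors //; apply/idP/allpairsP => [dab|].
  exists (gcdn d a, gcdn d b); rewrite -!dvdn_divisors //= !dvdn_gcdr; split=> //.
  apply/eqP; rewrite eqn_dvd; apply/andP; split.
    by rewrite muln_gcdr dvdn_gcd dvdn_mull // muln_gcdl dvdn_gcd dab dvdn_mulr.
  rewrite Gauss_dvd ?dvdn_gcdl //.
  by apply: coprime_dvdl (dvdn_gcdr _ _) _; apply: coprime_dvdr (dvdn_gcdr _ _) _.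
by case=> [[x y] /= []]; rewrite -!dvdn_divisors // => xa yb ->; exact: dvdn_mul.
Qed.

Lemma sigmaM a b : 0 < a -> 0 < b -> coprime a b ->
  sigma (a * b) = sigma a * sigma b.
Proof.
move=> a0 b0 cab; rewrite /sigma (perm_big _ (divisors_coprimeM a0 b0 cab)) /=.
rewrite big_allpairs_dep /= big_distrl /=; apply: eq_bigr => x _.
by rewrite big_distrr.
Qed.

Lemma tauM a b : 0 < a -> 0 < b -> coprime a b -> tau (a * b) = tau a * tau b.
Proof.
by move=> a0 b0 cab; rewrite /tau (perm_size (divisors_coprimeM a0 b0 cab)) size_allpairs.
Qed.

Lemma divisors_pfactor p a : prime p ->
  perm_eq (divisors (p ^ a)) [seq p ^ i | i <- iota 0 a.+1].
Proof.
move=> pp; have p0 : 0 < p ^ a by rewrite expn_gt0 prime_gt0.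
apply: uniq_perm; first exact: divisors_uniq.
  by rewrite map_inj_uniq ?iota_uniq //; apply: expnI; exact: prime_gt1.
move=> d; rewrite -dvdn_divisors //; apply/dvdn_pfactor/mapP => // -[i].
  by move=> ia ->; exists i; rewrite // mem_iota.
by rewrite mem_iota add0n ltnS => /andP[_ ia] ->; exists i.
Qed.

Lemma sigma_pfactor p a : prime p -> sigma (p ^ a) = \sum_(i < a.+1) p ^ i.
Proof.
move=> pp; rewrite /sigma (perm_big _ (divisors_pfactor a pp)) big_map.
by rewrite -[iota _ _]/(index_iota 0 a.+1) big_mkord.
Qed.

Lemma tau_pfactor p a : prime p -> tau (p ^ a) = a.+1.
Proof. by move=> pp; rewrite /tau (perm_size (divisors_pfactor a pp)) size_map size_iota. Qed.

Lemma sigma_prime p : prime p -> sigma p = p.+1.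
Proof. by move=> pp; rewrite -{1}(expn1 p) sigma_pfactor // big_ord_recr /= big_ord1 expn1. Qed.

Lemma tau_prime p : prime p -> tau p = 2.
Proof. by move=> pp; rewrite -{1}(expn1 p) tau_pfactor. Qed.

Lemma tau_gt0 n : 0 < tau n.
Proof. by rewrite /tau; case: (divisors n) (divisor1 n). Qed.

Lemma sigma_gt n : 1 < n -> n < sigma n.
Proof.
move=> n1; have n0 : 0 < n by exact: ltnW.
rewrite /sigma (big_rem n) ?divisors_id //=.
rewrite (big_rem 1) /= -1?addn1 ?leq_add2l ?leq_addr //.
by rewrite mem_rem_uniq ?divisors_uniq // inE /= divisor1 andbT neq_ltn n1.
Qed.

Lemma pfactor_split n p : 0 < n -> prime p -> p %| n ->
  exists a s, [/\ 0 < a, 0 < s, coprime (p ^ a) s, n = p ^ a * s & s < n].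
Proof.
move=> n0 pp pn; exists (logn p n), (n`_p^').
have e : n = p ^ logn p n * n`_p^' by rewrite -p_part partnC.
have a0 : 0 < logn p n by rewrite logn_gt0 mem_primes pp n0.
split=> //.
  by rewrite -p_part coprime_partC.
rewrite {2}e ltn_Pmull ?part_gt0 //; apply: leq_trans (ltn_expl _ (prime_gt1 pp)) => //.
Qed.

Lemma size_primes_pfactorM p a s : prime p -> 0 < a -> 0 < s ->
  coprime (p ^ a) s -> size (primes (p ^ a * s)) = (size (primes s)).+1.
Proof.
move=> pp a0 s0 cs; have pa0 : 0 < p ^ a by rewrite expn_gt0 prime_gt0.
suff /perm_size -> : perm_eq (primes (p ^ a * s)) (p :: primes s) by [].
apply: uniq_perm; rewrite ?primes_uniq //=.
  rewrite primes_uniq andbT mem_primes pp s0 /=.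
  by rewrite -prime_coprime //; move: cs; rewrite coprime_pexpl.
by move=> q; rewrite primesM // primesX // primes_prime // inE.
Qed.

(** Every prime power [p ^ a] in [n] contributes a factor [a + 1 >= 2] to [tau n]. *)
Lemma tau_ge_expn_omega n : 0 < n -> 2 ^ size (primes n) <= tau n.
Proof.
elim/ltn_ind: n => n IH n0.
have [n1|n1] := leqP n 1; first by have -> : n = 1 by lia.
have [a [s [a0 s0 cs e sn]]] := pfactor_split n0 (pdiv_prime n1) (pdiv_dvd n).
set p := pdiv n in cs e *; have pp : prime p by exact: pdiv_prime.
have pa0 : 0 < p ^ a by rewrite expn_gt0 prime_gt0.
rewrite {2}e tauM // tau_pfactor //.
have -> : size (primes n) = (size (primes s)).+1 by rewrite {1}e size_primes_pfactorM.
by rewrite expnS leq_mul // IH.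
Qed.

(** * Divisor counts of perfect numbers *)

Lemma tau_sigma_odd n : odd n -> odd (sigma n) = odd (tau n).
Proof.
move=> on; rewrite /sigma /tau; have n0 : 0 < n by case: n on.
have : forall d, d \in divisors n -> odd d.
  by move=> d; rewrite -dvdn_divisors // => /dvdn_odd; apply.
elim: (divisors n) => [|d s IH] h; first by rewrite big_nil.
rewrite big_cons oddD h ?mem_head //= IH // => e es; apply: h; rewrite inE es orbT //.
Qed.

(** Either some exponent has [4 %| a.+1], and then [sigma (p ^ a)] has the factor
    [(1 + p) * (1 + p ^ 2)], or two exponents are odd and each gives an even factor. *)
Lemma four_dvd_tau_sigma n : odd n -> 4 %| tau n -> 4 %| sigma n.
Proof.
elim/ltn_ind: n => n IH on.
have n0 : 0 < n by case: n on IH.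
have [n1|n1] := leqP n 1; first by have -> : n = 1 by lia.
have [a [s [a0 s0 cs e sn]]] := pfactor_split n0 (pdiv_prime n1) (pdiv_dvd n).
set p := pdiv n in cs e *; have pp : prime p by exact: pdiv_prime.
have op : odd p by apply: dvdn_odd on; exact: pdiv_dvd.
have os : odd s by move: on; rewrite e oddM => /andP[].
have opa : odd (p ^ a) by rewrite oddX op orbT.
have pa0 : 0 < p ^ a by rewrite expn_gt0 prime_gt0.
rewrite e tauM // sigmaM // [tau (p ^ a)]tau_pfactor // => h4.
have [h|h] := boolP (4 %| a.+1).
  apply: dvdn_mulr; rewrite sigma_pfactor //.
  have /dvdnP[b ->] := h; elim: b => [|b IHb]; first by rewrite big_ord0.
  rewrite mulSn addnC; move: IHb; set c := b * 4 => IHb.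
  rewrite !addnS addn0 !big_ord_recr /= -!addnA dvdn_addr //.
  have -> : p ^ c + (p ^ c.+1 + (p ^ c.+2 + p ^ c.+3)) = p ^ c * ((1 + p) * (1 + p ^ 2)).
    by rewrite !expnS; lia.
  apply: dvdn_mull; rewrite (_ : 4 = 2 * 2) // dvdn_mul // dvdn2 oddD /= ?oddX op //.
have [h2|h2] := boolP (odd a.+1).
  apply: dvdn_mull; apply: IH => //; rewrite -(@Gauss_dvdr _ a.+1) //.
  by rewrite (_ : 4 = 2 ^ 2) // coprime_pexpl // coprime2n.
have ta : odd (tau s) = false.
  apply/negbTE; apply: contra h => ots.
  rewrite -(@Gauss_dvdl _ _ (tau s)) // (_ : 4 = 2 ^ 2) // coprime_pexpl // coprime2n //.
rewrite (_ : 4 = 2 * 2) // dvdn_mul // dvdn2; last by rewrite tau_sigma_odd // ta.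
by rewrite tau_sigma_odd // tau_pfactor.
Qed.

(** [2 * n] is even but not divisible by 4, and both facts pass from [sigma n] to [tau n]. *)
Lemma odd_perfect_tau n : odd n -> perfect n -> tau n %% 4 = 2.
Proof.
move=> on [n0 e]; have := tau_sigma_odd on; rewrite e oddM /= => et.
have h4 : ~~ (4 %| tau n).
  apply/negP => /(four_dvd_tau_sigma on); rewrite e; lia.
move: et h4; lia.
Qed.

(** The divisors [s] and [c] already exhaust [sigma s], so there is no third one. *)
Lemma sigma_two_divisors s c : 1 < s -> c %| s -> c < s -> sigma s = s + c ->
  c = 1 /\ prime s.
Proof.
move=> s1 cs lcs e; have s0 : 0 < s by exact: ltnW.
have c0 : 0 < c by exact: dvdn_gt0 cs.
have key d : d %| s -> d = s \/ d = c.
  move=> ds; have [->|nds] := eqVneq d s; first by left.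
  have [->|ndc] := eqVneq d c; first by right.
  have d0 : 0 < d by exact: dvdn_gt0 ds.
  exfalso; move: e; rewrite /sigma (big_rem s) ?divisors_id //= => /addnI.
  rewrite (big_rem c) /=; last first.
    by rewrite mem_rem_uniq ?divisors_uniq // inE /= -dvdn_divisors // cs andbT neq_ltn lcs.
  rewrite (big_rem d) /=; first by lia.
  rewrite mem_rem_uniq ?rem_uniq ?divisors_uniq // inE /= ndc.
  by rewrite mem_rem_uniq ?divisors_uniq // inE /= nds -dvdn_divisors.
have c1 : c = 1 by case: (key 1 (dvd1n _)); lia.
split=> //; apply/primeP; split=> // d /key; rewrite c1 => -[] ->; rewrite eqxx ?orbT //.
Qed.

Lemma prime_mersenne q : prime (2 ^ q - 1) -> prime q.
Proof.
case: q => [|[|q]] // pq; apply/primeP; split=> // d /dvdnP[c e].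
have : 2 ^ d - 1 %| 2 ^ q.+2 - 1.
  by rewrite !subn1 e mulnC expnM (predn_exp (2 ^ d)) dvdn_mulr.
move/primeP: pq => [_ h] /h.
have d0 : 0 < d by case: d e {h} => //; rewrite muln0.
have := expn_gt0 2 d; have := expn_gt0 2 q.+2 => /= ? ?.
move=> /orP[/eqP e1|/eqP e1]; apply/orP; [left|right]; apply/eqP.
  by apply: (@expnI 2) => //; rewrite expn1; lia.
by apply: (@expnI 2) => //; lia.
Qed.

(** Euclid-Euler: for [n = 2 ^ a * s], the cofactor [c] of [2 ^ a.+1 - 1] in [s] satisfies
    [sigma s = s + c], so [s] is a Mersenne prime with exponent [q = a.+1]. *)
Lemma even_perfect_tau n : ~~ odd n -> perfect n ->
  exists q, [/\ prime q, prime (2 ^ q - 1) & tau n = 2 * q].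
Proof.
move=> on [n0 e].
have [a [s [a0 s0 cs en sn]]] := pfactor_split n0 (isT : prime 2) (etrans (dvdn2 n) on).
have e2 : sigma (2 ^ a) = 2 ^ a.+1 - 1.
  by rewrite sigma_pfactor // [RHS]subn1 predn_exp mul1n.
have pa : 2 < 2 ^ a.+1 by rewrite expnS; case: a a0 {e2 en cs} => // a _; have := expn_gt0 2 a; rewrite expnS /=; lia.
move: e; rewrite en sigmaM ?expn_gt0 // e2 mulnA -expnS => e.
have : 2 ^ a.+1 - 1 %| s.
  rewrite -(@Gauss_dvdr _ (2 ^ a.+1)); first by rewrite -e dvdn_mulr.
  by rewrite coprime_sym subn1 coprimenP ?expn_gt0.
move=> /dvdnP[c es].
have es2 : sigma s = s + c.
  apply/eqP; rewrite -(eqn_pmul2l (m := 2 ^ a.+1 - 1)); last by lia.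
  by apply/eqP; rewrite e es; nia.
have c0 : 0 < c by case: c es {es2} => //; lia.
have [c1 ps] : c = 1 /\ prime s.
  apply: sigma_two_divisors es2; [| by rewrite es dvdn_mulr|]; nia.
have pq : prime (2 ^ a.+1 - 1) by rewrite -[_ - 1]mul1n -{1}c1 -es.
exists a.+1; split=> //; first exact: prime_mersenne.
by rewrite tauM ?expn_gt0 // tau_pfactor // tau_prime // mulnC.
Qed.

(** * Exactly perfect numbers and multiplication by a prime *)

Lemma perm_divisors_proper n : 0 < n ->
  perm_eq (divisors n) (n :: proper_divisors n).
Proof.
move=> n0; apply: uniq_perm; rewrite ?divisors_uniq //=.
  by rewrite mem_filter ltnn /= filter_uniq // divisors_uniq.
move=> d; rewrite inE mem_filter -dvdn_divisors //.
have [->|ndn] := eqVneq d n; first by rewrite dvdnn.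
by case dn: (d %| n); rewrite ?andbF // ltn_neqAle ndn dvdn_leq.
Qed.

Lemma mem_proper_divisors n d : 0 < n ->
  (d \in proper_divisors n) = (d %| n) && (d < n).
Proof. by move=> n0; rewrite mem_filter -dvdn_divisors // andbC. Qed.

(** Adding [n] and the omitted divisors to both sides turns the definition into an equation for
    [sigma n]. *)
Lemma exactly_perfectP k n : exactly_perfect k n <->
  0 < n /\ exists D : seq nat,
    [/\ uniq D, {in D, forall d, (d %| n) && (d < n)}, size D = k &
        sigma n = 2 * n + \sum_(d <- D) d].
Proof.
split=> -[n0 [D [uD sD kD eD]]]; split=> //; exists D;
  have sig : sigma n = n + \sum_(d <- D) d + \sum_(d <- proper_divisors n | d \notin D) d.
- rewrite /sigma (perm_big _ (perm_divisors_proper n0)) big_cons -addnA; congr addn.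
  rewrite (bigID (mem D)) /= -big_filter; congr addn; apply: perm_big.
  apply: uniq_perm; rewrite ?filter_uniq ?divisors_uniq // => d.
  by rewrite mem_filter andb_idr //; exact: sD.
- split=> //; first by move=> d dD; rewrite -mem_proper_divisors //; exact: sD.
  by rewrite sig -eD; lia.
- rewrite /sigma (perm_big _ (perm_divisors_proper n0)) big_cons -addnA; congr addn.
  rewrite (bigID (mem D)) /= -big_filter; congr addn; apply: perm_big.
  apply: uniq_perm; rewrite ?filter_uniq ?divisors_uniq // => d.
  by rewrite mem_filter andb_idr // => dD; rewrite mem_proper_divisors //; exact: sD.
- split=> //; first by move=> d dD; rewrite mem_proper_divisors //; exact: sD.
  by move: eD sig; lia.
Qed.

Lemma exactly_perfect0 n : exactly_perfect 0 n <-> perfect n.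
Proof.
rewrite exactly_perfectP /perfect; split=> -[n0].
  by case=> D [_ _ /size0nil -> ->]; rewrite big_nil addn0.
by move=> e; split=> //; exists [::]; rewrite big_nil addn0.
Qed.

Lemma exactly_perfect_sigma k n : exactly_perfect k n -> 2 * n + k <= sigma n.
Proof.
move=> /exactly_perfectP[n0 [D [_ sD <- ->]]]; rewrite leq_add2l -sum1_size.
rewrite big_seq [leqRHS]big_seq; apply: leq_sum => d /sD /andP[dn _].
exact: dvdn_gt0 dn.
Qed.

Lemma sigma_mul_prime m p : 0 < m -> prime p -> ~~ (p %| m) ->
  sigma (m * p) = sigma m * p.+1.
Proof.
move=> m0 pp pm; rewrite sigmaM ?(sigma_prime pp) ?(prime_gt0 pp) //.
by rewrite coprime_sym prime_coprime.
Qed.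

Lemma tau_mul_prime m p : 0 < m -> prime p -> ~~ (p %| m) ->
  tau (m * p) = 2 * tau m.
Proof.
move=> m0 pp pm; rewrite tauM ?(tau_prime pp) ?(prime_gt0 pp) 1?mulnC //.
by rewrite coprime_sym prime_coprime.
Qed.

(** The divisors to omit are all those of [m] together with [p] times those omitted for [m]; the two
    families are disjoint because [p] does not divide [m]. *)
Lemma exactly_perfect_mul_prime j m p : exactly_perfect j m -> prime p ->
  ~~ (p %| m) -> exactly_perfect (j + tau m) (m * p).
Proof.
move=> /exactly_perfectP[m0 [D [uD sD kD eD]]] pp pm.
have p0 := prime_gt0 pp; have p1 := prime_gt1 pp.
apply/exactly_perfectP; rewrite muln_gt0 m0 p0; split=> //.
exists (divisors m ++ [seq d * p | d <- D]); split.
- rewrite cat_uniq divisors_uniq map_inj_uniq ?uD; last first.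
    by move=> x y /eqP; rewrite eqn_pmul2r // => /eqP.
  rewrite andbT /=; apply/hasPn => _ /mapP[d dD ->].
  rewrite -dvdn_divisors //; apply: contra pm; apply: dvdn_trans.
  exact: dvdn_mull.
- move=> d; rewrite mem_cat -dvdn_divisors // => /orP[dm|/mapP[e eD' ->]].
    by rewrite dvdn_mulr //=; have := dvdn_leq m0 dm; nia.
  by have /andP[em lem] := sD _ eD'; rewrite dvdn_pmul2r // em ltn_pmul2r.
- by rewrite size_cat size_map kD addnC.
- rewrite big_cat big_map /= -big_distrl /= sigma_mul_prime // -/(sigma m).
  by move: eD; set s := \sum_(_ <- _) _; nia.
Qed.

(** The divisors missing from [D] are positive and sum to 0. *)
Lemma sub_divisors_sum_sigma (D : seq nat) m : 0 < m -> uniq D ->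
  {in D, forall d, d %| m} -> \sum_(d <- D) d = sigma m -> size D = tau m.
Proof.
move=> m0 uD sD; rewrite /sigma [in RHS](bigID (mem D)) /= -[in RHS]big_filter.
have pD : perm_eq [seq d <- divisors m | d \in D] D.
  apply: uniq_perm; rewrite ?filter_uniq ?divisors_uniq // => d.
  by rewrite mem_filter andb_idr // -dvdn_divisors // => /sD.
rewrite [in RHS](perm_big _ pD) /= -[LHS]addn0 => /addnI /esym /eqP.
rewrite sum_nat_seq_eq0 => /allP h; apply/eqP; rewrite eqn_leq; apply/andP; split.
  by apply: uniq_leq_size => // d /sD; rewrite dvdn_divisors.
apply: uniq_leq_size; first exact: divisors_uniq.
move=> d dm; have := h d dm; case: (boolP (d \in D)) => //= _.
by move: dm; rewrite -dvdn_divisors // => /(dvdn_gt0 m0); case: d.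
Qed.

(** [D1] comes from the omitted divisors that are multiples of [p], after division by [p]; [D0]
    consists of the others. *)
Lemma exactly_perfect_factor k m p : prime p -> ~~ (p %| m) ->
  exactly_perfect k (m * p) ->
  exists D1 D0 : seq nat,
    [/\ uniq D1 /\ {in D1, forall d, (d %| m) && (d < m)},
        uniq D0 /\ {in D0, forall d, d %| m}, size D1 + size D0 = k &
        sigma m * p.+1 = (2 * m + \sum_(d <- D1) d) * p + \sum_(d <- D0) d].
Proof.
move=> pp pm /exactly_perfectP[]; rewrite muln_gt0 => /andP[m0 p0] [D [uD sD kD]].
rewrite sigma_mul_prime // => eD.
pose S := [seq d <- D | p %| d].
exists [seq d %/ p | d <- S], [seq d <- D | ~~ (p %| d)]; split.
- split.
    rewrite map_inj_in_uniq ?filter_uniq // => x y.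
    rewrite !mem_filter => /andP[px _] /andP[py _] e.
    by rewrite -(divnK px) -(divnK py) e.
  move=> _ /mapP[d + ->]; rewrite mem_filter => /andP[pd /sD /andP[dn ldn]].
  by rewrite dvdn_divLR // dn ltn_divLR.
- split; first exact: filter_uniq.
  move=> d; rewrite mem_filter => /andP[pd /sD /andP[dn _]].
  by rewrite -(@Gauss_dvdl _ _ p) // coprime_sym prime_coprime.
- by rewrite size_map !size_filter count_predC.
- rewrite eD (bigID (fun d => p %| d)) /= !big_filter mulnDl addnA mulnA.
  congr (_ + _ + _); rewrite big_map big_filter big_distrl /=.
  by apply: eq_bigr => d pd; rewrite divnK.
Qed.

(** * Counting functions and divisor sums *)

Definition cnt (P : nat -> Prop) (N : nat) : nat :=
  count (fun n => `[< P n >]) (iota 1 N).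

Lemma cntE P N : cnt P N = \sum_(1 <= n < N.+1) `[< P n >].
Proof. by rewrite /cnt -sum1_count big_mkcond /= /index_iota subn1; apply: eq_bigr => n _; case: ifP. Qed.

Lemma cnt_le_codes (C : finType) (f : C -> nat) P N :
  (forall n, 0 < n <= N -> P n -> exists c, f c = n) -> cnt P N <= #|C|.
Proof.
move=> h; rewrite /cnt -size_filter cardE -(size_map f); apply: uniq_leq_size.
  by rewrite filter_uniq ?iota_uniq.
move=> n; rewrite mem_filter mem_iota => /andP[/asboolP Pn nN].
have [|c <-] := h n _ Pn; first by lia.
by rewrite map_f ?mem_enum.
Qed.

Lemma cnt_cover (I : eqType) (s : seq I) (Q : I -> nat -> Prop) P N :
  (forall n, 0 < n <= N -> P n -> exists2 i, i \in s & Q i n) ->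
  cnt P N <= \sum_(i <- s) cnt (Q i) N.
Proof.
move=> h; rewrite cntE; have -> : \sum_(i <- s) cnt (Q i) N = \sum_(i <- s) \sum_(1 <= n < N.+1) `[< Q i n >].
  by apply: eq_bigr => i _; rewrite cntE.
rewrite exchange_big /= big_nat [leqRHS]big_nat; apply: leq_sum => n nN.
case: asboolP => // Pn; have [i is_ Qi] := h n nN Pn.
by rewrite (big_rem i) //= asboolT.
Qed.

Lemma cnt_sub P Q N : (forall n, 0 < n <= N -> P n -> Q n) -> cnt P N <= cnt Q N.
Proof.
move=> h; rewrite !cntE big_nat [leqRHS]big_nat; apply: leq_sum => n nN.
by case: asboolP => // Pn; rewrite asboolT //; exact: h.
Qed.

Lemma cnt_or P Q N : cnt (fun n => P n \/ Q n) N <= cnt P N + cnt Q N.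
Proof.
rewrite !cntE -big_split /=; apply: leq_sum => n _.
by case: asboolP => // -[h|h]; rewrite (asboolT h) ?leq_addr ?leq_addl.
Qed.

Lemma cnt_leq P N : cnt P N <= N.
Proof. by rewrite /cnt (leq_trans (count_size _ _)) ?size_iota. Qed.

Lemma cnt_homo P N N' : N <= N' -> cnt P N <= cnt P N'.
Proof. by move=> h; rewrite /cnt -(subnKC h) iotaD count_cat leq_addr. Qed.

Lemma cnt_mul d Q N : 0 < d ->
  cnt (fun n => exists2 m, n = m * d & Q m) N <= cnt Q (N %/ d).
Proof.
move=> d0; rewrite /cnt -!size_filter.
rewrite -(size_map (fun m => m * d) [seq n <- iota 1 (N %/ d) | _]).
apply: uniq_leq_size; first by rewrite filter_uniq ?iota_uniq.
move=> n; rewrite mem_filter mem_iota => /andP[/asboolP[m -> Qm] nN].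
apply/mapP; exists m => //; rewrite mem_filter mem_iota asboolT //=.
have : m <= N %/ d by rewrite leq_divRL //; lia.
by case: m nN {Qm} => //= m; lia.
Qed.

Lemma cnt_dvdn d N : 0 < d -> cnt (fun n => d %| n) N <= N %/ d.
Proof.
move=> d0; apply: leq_trans (cnt_leq (fun=> True) _).
apply: leq_trans (cnt_mul _ _ d0); apply: cnt_sub => n _ /dvdnP[m ->].
by exists m.
Qed.

(** Each dyadic block of [d] from [2 ^ i] to [2 ^ i.+1] contributes at most [N]. *)
Lemma harmonic_sum N : \sum_(1 <= d < N.+1) N %/ d <= N * (trunc_log 2 N).+1.
Proof.
have h i : \sum_(1 <= d < 2 ^ i) N %/ d <= N * i.
  elim: i => [|i IH]; first by rewrite big_geq.
  have p0 : 0 < 2 ^ i by rewrite expn_gt0.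
  rewrite (big_cat_nat (n := 2 ^ i)) //=; last by rewrite leq_exp2l.
  rewrite mulnS addnC leq_add // big_nat.
  apply: (@leq_trans (\sum_(2 ^ i <= d < 2 ^ i.+1) N %/ 2 ^ i)).
    by rewrite [leqRHS]big_nat; apply: leq_sum => d /andP[hd _]; rewrite leq_div2l.
  by rewrite sum_nat_const_nat expnS mul2n -addnn addnK mulnC leq_divM.
apply: leq_trans (h _); have := trunc_log_ltn N (isT : 1 < 2) => lt.
rewrite (big_cat_nat (n := N.+1) (p := 2 ^ _)) //= leq_addr //.
Qed.

(** Markov's inequality for [tau], whose sum up to [N] is at most the harmonic sum. *)
Lemma cnt_tau_ge T N : T * cnt (fun n => T <= tau n) N <= N * (trunc_log 2 N).+1.
Proof.
apply: leq_trans (harmonic_sum N).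
apply: (@leq_trans (\sum_(1 <= n < N.+1) tau n)).
  rewrite cntE big_distrr /=; apply: leq_sum => n _.
  by case: asboolP => h; rewrite ?muln1 ?muln0.
apply: (@leq_trans (\sum_(1 <= n < N.+1) \sum_(1 <= d < N.+1) (d %| n))).
  rewrite big_nat [leqRHS]big_nat; apply: leq_sum => n /andP[n0 nN].
  rewrite /tau -big_mkcond /= sum1_count -size_filter; apply: uniq_leq_size.
    exact: divisors_uniq.
  move=> d; rewrite -dvdn_divisors // mem_filter => dn; rewrite dn mem_index_iota /=.
  by rewrite (dvdn_gt0 n0 dn) (leq_ltn_trans (dvdn_leq n0 dn)).
rewrite exchange_big /= big_nat [leqRHS]big_nat; apply: leq_sum => d /andP[d0 dN].
apply: leq_trans (cnt_dvdn N d0); rewrite cntE; apply: leq_sum => n _.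
by rewrite asboolb.
Qed.

(** * Eventual properties and sparse sets *)

Definition evt (P : nat -> Prop) := exists X, forall N, X <= N -> P N.

Lemma evt_and P Q : evt P -> evt Q -> evt (fun N => P N /\ Q N).
Proof.
move=> [X hX] [Y hY]; exists (maxn X Y) => N; rewrite geq_max => /andP[h1 h2].
by split; [exact: hX | exact: hY].
Qed.

Lemma evt_sub (P Q : nat -> Prop) : (forall N, P N -> Q N) -> evt P -> evt Q.
Proof. by move=> h [X hX]; exists X => N /hX /h. Qed.

Lemma evt_log c : evt (fun N => c <= trunc_log 2 N).
Proof. by exists (2 ^ c) => N h; apply: trunc_log_max. Qed.

Lemma evt_comp_log (P : nat -> Prop) : evt P -> evt (fun N => P (trunc_log 2 N)).
Proof. by case=> X hX; case: (evt_log X) => Y hY; exists Y => N /hY /hX. Qed.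

Lemma cube_le_exp2 n : 10 <= n -> n ^ 3 <= 2 ^ n.
Proof.
move=> /subnKC <-; elim: (n - 10) => [|m IH]; first by rewrite addn0; lia.
rewrite addnS [leqRHS]expnS; apply: leq_trans (_ : 2 * (10 + m) ^ 3 <= _); last by lia.
rewrite !expnS !expn0; nia.
Qed.

(** With [b] the logarithm of [L]: [b.+1 ^ 2 * c <= 4 * c * b ^ 2 <= b ^ 3 <= 2 ^ b <= L]. *)
Lemma evt_log_sqr c : evt (fun L => (trunc_log 2 L).+1 ^ 2 * c <= L).
Proof.
case: (evt_log (maxn 10 (4 * c))) => X hX; exists (maxn X 1) => N.
rewrite geq_max => /andP[/hX]; rewrite geq_max => /andP[h1 h2] N0.
apply: leq_trans (trunc_logP (isT : 1 < 2) N0).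
apply: leq_trans (cube_le_exp2 h1).
by move: (trunc_log 2 N) h1 h2 => b h1 h2; rewrite !expnS !expn0; nia.
Qed.

(** Allowing every power of the logarithm leaves room for finite unions and for sums over [p] of
    [1 / p], and beats the order [N / log N] of the sets to be compared. *)
Definition sparse (P : nat -> Prop) :=
  forall A, evt (fun N => cnt P N * trunc_log 2 N ^ A <= N).

Lemma sparse_sub (P Q : nat -> Prop) : (forall n, 0 < n -> P n -> Q n) ->
  sparse Q -> sparse P.
Proof.
move=> h sQ A; apply: evt_sub (sQ A) => N; apply: leq_trans.
by rewrite leq_mul2r cnt_sub ?orbT // => n /andP[n0 _]; exact: h.
Qed.

Lemma sparse_or P Q : sparse P -> sparse Q -> sparse (fun n => P n \/ Q n).
Proof.
move=> sP sQ A; apply: evt_sub (evt_and (evt_log 2) (evt_and (sP A.+1) (sQ A.+1))).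
move=> N [h2 [h3 h4]]; have := cnt_or P Q N; move: h3 h4; rewrite expnS.
move: (trunc_log 2 N) (cnt P N) (cnt Q N) (cnt (fun n => P n \/ Q n) N) h2 => L a b c L2 ha hb hc.
apply: leq_trans (leq_mul hc (leqnn _)) _; rewrite mulnDl.
have ha' : 2 * (a * L ^ A) <= N by apply: leq_trans ha; rewrite mulnCA leq_mul2l leq_mul2r L2 !orbT.
have hb' : 2 * (b * L ^ A) <= N by apply: leq_trans hb; rewrite mulnCA leq_mul2l leq_mul2r L2 !orbT.
lia.
Qed.

Lemma sparse_exists k (P : nat -> nat -> Prop) :
  (forall j, j < k -> sparse (P j)) -> sparse (fun n => exists2 j, j < k & P j n).
Proof.
elim: k => [_ A|k IH h].
  exists 0 => N _; rewrite (_ : cnt _ N = 0) //; apply/eqP; rewrite -leqn0.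
  apply: (@leq_trans (cnt (fun=> False) N)); first by apply: cnt_sub => n _ [].
  by rewrite cntE big1 // => n _; rewrite asboolF.
have h1 : sparse (fun n => (exists2 j, j < k & P j n) \/ P k n).
  by apply: sparse_or; [apply: IH => j jk; apply: h; lia | exact: h].
apply: sparse_sub h1 => n _ [j jk Pj]; have [e|ne] := eqVneq j k; first by right; rewrite -e.
by left; exists j => //; lia.
Qed.

(* The prime [p] below costs only a factor [sum 1/p <= log N], while [p <= m] keeps
   [log m] comparable to [log N]. *)
Lemma sparse_mul Q : sparse Q ->
  sparse (fun n => exists m p, [/\ 0 < p, p <= m, n = m * p & Q m]).
Proof.
(* Of the two extra logarithms, one pays for the harmonic sum, the other for the constant
   [3 ^ A.+2]. *)
move=> sQ A; case: (sQ A.+2) => X hX.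
case: (evt_log (maxn (2 * X).+2 (2 * 3 ^ A.+2))) => Y hY; exists Y => N /hY.
rewrite geq_max; set L := trunc_log 2 N => /andP[L1 L2].
have N0 : 0 < N by rewrite lt0n; apply/eqP => e; move: L1; rewrite /L e trunc_log0.
pose s := [seq p <- index_iota 1 N.+1 | p * p <= N].
have h1 : cnt (fun n => exists m p, [/\ 0 < p, p <= m, n = m * p & Q m]) N
    <= \sum_(p <- s) cnt Q (N %/ p).
  apply: leq_trans (_ : \sum_(p <- s) cnt (fun n => exists2 m, n = m * p & Q m) N <= _).
    apply: cnt_cover => n /andP[n0 nN] [m [p [p0 pm e Qm]]].
    by exists p; [rewrite mem_filter mem_index_iota p0; nia | exists m].
  rewrite big_seq [leqRHS]big_seq; apply: leq_sum => p.
  by rewrite mem_filter mem_index_iota => /andP[_ /andP[p0 _]]; exact: cnt_mul.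
have h2 : \sum_(p <- s) cnt Q (N %/ p) * L ^ A.+2 <= \sum_(p <- s) 3 ^ A.+2 * (N %/ p).
  rewrite big_seq [leqRHS]big_seq; apply: leq_sum => p.
  rewrite mem_filter mem_index_iota => /andP[pp /andP[p0 _]].
  set m := N %/ p; have pm : p <= m by rewrite leq_divRL.
  (* As [p <= m], the quotient [m] is about the square root of [N] or larger. The factor 3 in [lm],
     instead of 2, absorbs the rounding. *)
  have hm : 2 ^ L./2 <= m.
    rewrite -ltnS -(@ltn_exp2r _ _ 2) // -expnM.
    apply: (@leq_ltn_trans N); last first.
      apply: leq_trans (ltn_ceil N p0) _; rewrite -/m expnS expn1; nia.
    apply: leq_trans (trunc_logP (isT : 1 < 2) N0); rewrite leq_exp2l // -/L; lia.
  have lm : L <= 3 * trunc_log 2 m.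
    have := trunc_log_max (isT : 1 < 2) hm; lia.
  have Xm : X <= m.
    apply: leq_trans hm; apply: leq_trans (_ : L./2 <= _); first by lia.
    exact: ltnW (ltn_expl _ _).
  apply: leq_trans (_ : 3 ^ A.+2 * (cnt Q m * trunc_log 2 m ^ A.+2) <= _); last first.
    by rewrite leq_mul2l hX // orbT.
  by rewrite mulnCA -expnMn leq_mul2l leq_exp2r // lm orbT.
have h3 : \sum_(p <- s) 3 ^ A.+2 * (N %/ p) <= 3 ^ A.+2 * (N * L.+1).
  rewrite -big_distrr /= leq_mul2l; apply/orP; right.
  apply: leq_trans (harmonic_sum N); rewrite big_filter big_mkcond /=.
  by apply: leq_sum => p _; case: ifP.
move: h2 h3; rewrite -big_distrl /= => h2 h3.
have := leq_trans (leq_mul h1 (leqnn (L ^ A.+2))) (leq_trans h2 h3).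
move: L1 L2; rewrite [L ^ _]expnS [L ^ _.+1]expnS.
move: (cnt _ N) (3 ^ A.+2) (L ^ A) => a b c L1 L2 h.
have : a * c * (L * L) <= N * (L * L); last first.
  by rewrite leq_pmul2r // muln_gt0; lia.
apply: leq_trans (_ : b * (N * L.+1) <= _); first by move: h; nia.
rewrite mulnCA leq_mul2l; apply/orP; right; nia.
Qed.

(** * Splitting off the largest prime factor *)

Definition max_prime_extension k n := exists m p j,
  [/\ prime p, ~~ (p %| m), n = m * p, (forall q, prime q -> q %| n -> q <= p) &
      exactly_perfect j m /\ j + tau m = k].

(* The largest prime is determined by the cofactor [m] and the choice of the omitted
   divisors, the sum of those divisible by [p] being [A * p]. *)
Definition decode_prime m A B :=
  ((sigma m - B) + (B - sigma m)) %/ ((2 * m + A - sigma m) + (sigma m - (2 * m + A))).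

(** The equation says that [sigma m - (2 * m + A)] times [p] is [B - sigma m]. A truncated
    difference plus its reverse is the absolute value, which covers both signs. *)
Lemma decode_primeP m p A B : sigma m * p.+1 = (2 * m + A) * p + B ->
  2 * m + A <> sigma m -> decode_prime m A B = p.
Proof.
rewrite /decode_prime; move: (2 * m + A) (sigma m) => u v e ne.
have [h|h] : u < v \/ v < u by lia.
  have -> : v - B + (B - v) = p * (u - v + (v - u)) by nia.
  by rewrite mulnK; lia.
have -> : v - B + (B - v) = p * (u - v + (v - u)) by nia.
by rewrite mulnK; lia.
Qed.

Definition determined k T y n := exists m p D1 D0,
  [/\ [/\ n = m * p, 0 < m, y < p & tau m < T],
      {in D1, forall d, d %| m} /\ {in D0, forall d, d %| m},
      size D1 + size D0 = k &
      decode_prime m (\sum_(d <- D1) d) (\sum_(d <- D0) d) = p].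

(** There are at most [N %/ y] values of [m], and each of the [k] divisors is coded by its index in
    [divisors m] and a bit telling [D1] from [D0]; [p] is then decoded. *)
Lemma cnt_determined k T y N : 0 < y ->
  cnt (determined k T y) N <= N %/ y * (2 * T.+1) ^ k.
Proof.
move=> y0.
pose C : finType := ('I_(N %/ y) * {ffun 'I_k -> 'I_T.+1 * bool})%type.
have -> : N %/ y * (2 * T.+1) ^ k = #|C|.
  by rewrite card_prod card_ffun card_prod !card_ord card_bool [T.+1 * 2]mulnC.
pose S (c : C) b := \sum_(i < k | (c.2 i).2 == b) nth 0 (divisors c.1.+1) (c.2 i).1.
apply: (@cnt_le_codes _ (fun c : C => c.1.+1 * decode_prime c.1.+1 (S c true) (S c false))).
move=> n /andP[n0 nN] [m [p [D1 [D0 [[en m0 yp tm] [s1 s0] sk ep]]]]].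
have hm : m.-1 < N %/ y.
  by rewrite prednK // leq_divRL //; nia.
pose s := [seq (d, true) | d <- D1] ++ [seq (d, false) | d <- D0].
have ss : size s = k by rewrite size_cat !size_map.
pose g (i : 'I_k) : 'I_T.+1 * bool :=
  (inord (index (nth (0, true) s i).1 (divisors m)), (nth (0, true) s i).2).
exists (Ordinal hm, finfun g).
have eS b : S (Ordinal hm, finfun g) b = \sum_(x <- s | x.2 == b) x.1.
  rewrite /S /= prednK // (big_nth (0, true)) ss big_mkord.
  apply: eq_big => [i|i _]; rewrite ffunE //=.
  have : nth (0, true) s i \in s by rewrite mem_nth ?ss.
  set x := nth _ s i; rewrite mem_cat => xs.
  have xm : x.1 %| m by case/orP: xs => /mapP[d dD ->] /=; [exact: s1 | exact: s0].
  rewrite inordK; first by rewrite nth_index // -dvdn_divisors.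
  apply: leq_trans (_ : tau m <= _); last by lia.
  by rewrite index_mem -dvdn_divisors.
have e1 : S (Ordinal hm, finfun g) true = \sum_(d <- D1) d.
  by rewrite eS big_cat !big_map /= big_pred0_eq addn0.
have e0 : S (Ordinal hm, finfun g) false = \sum_(d <- D0) d.
  by rewrite eS big_cat !big_map /= big_pred0_eq add0n.
by rewrite e1 e0 /= prednK // ep en.
Qed.

(** Such an [n] has fewer than [w] prime factors, so it is coded by [w] pairs of a prime at most [y]
    and an exponent at most the logarithm of [N]. *)
Lemma cnt_smooth w y N :
  cnt (fun n => tau n < 2 ^ w /\ (forall q, prime q -> q %| n -> q <= y)) N
  <= (y.+1 * (trunc_log 2 N).+1) ^ w.
Proof.
set L := trunc_log 2 N.
pose C : finType := {ffun 'I_w -> 'I_y.+1 * 'I_L.+1}.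
have -> : (y.+1 * L.+1) ^ w = #|C| by rewrite card_ffun card_prod !card_ord.
apply: (@cnt_le_codes _ (fun c : C => \prod_(i < w) (c i).1 ^ (c i).2)).
move=> n /andP[n0 nN] [tn sn].
have sw : size (prime_decomp n) < w.
  rewrite -(ltn_exp2l (m := 2)) //; apply: leq_ltn_trans tn.
  by rewrite prime_decompE size_map tau_ge_expn_omega.
exists [ffun i : 'I_w => (inord (nth (0, 0) (prime_decomp n) i).1,
                          inord (nth (0, 0) (prime_decomp n) i).2)].
pose F i := (nth (0, 0) (prime_decomp n) i).1 ^ (nth (0, 0) (prime_decomp n) i).2.
rewrite [RHS](prod_prime_decomp n0) (big_nth (0, 0)) big_mkord.
rewrite (big_ord_widen w F (ltnW sw)) [RHS]big_mkcond /=.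
apply: eq_bigr => i _; rewrite !ffunE /= /F.
(* Past the last prime factor the default pair [(0, 0)] contributes [0 ^ 0 = 1]. *)
case: ltnP => hi; last by rewrite nth_default //= !inordK.
have : nth (0, 0) (prime_decomp n) i \in prime_decomp n by rewrite mem_nth.
case: (nth _ _ _) => p e /mem_prime_decomp[pp e0 pn] /=; rewrite !inordK //.
  rewrite ltnS; apply: trunc_log_max => //; apply: leq_trans nN.
  apply: leq_trans (dvdn_leq n0 pn); rewrite leq_exp2r //; exact: prime_gt1.
by rewrite ltnS sn //; apply: dvdn_trans pn; exact: dvdn_exp.
Qed.

(** For [d > y], [N / d ^ 2] is at most [(N / y) / d], which reduces the sum to a harmonic one. *)
Lemma cnt_square y N : 0 < y ->
  cnt (fun n => exists2 d, y < d & d * d %| n) N <= N %/ y * (trunc_log 2 N).+1.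
Proof.
move=> y0; pose s := [seq d <- index_iota 1 N.+1 | y < d].
apply: leq_trans (_ : \sum_(d <- s) cnt (fun n => d * d %| n) N <= _).
  apply: cnt_cover => n /andP[n0 nN] [d yd dn]; exists d => //.
  rewrite mem_filter mem_index_iota yd; have := dvdn_leq n0 dn; nia.
apply: leq_trans (_ : \sum_(d <- s) N %/ y %/ d <= _).
  rewrite big_seq [leqRHS]big_seq; apply: leq_sum => d.
  rewrite mem_filter => /andP[yd _].
  apply: leq_trans (cnt_dvdn _ _) _; first by nia.
  by rewrite -divnMA leq_div2l //; nia.
have [h|h] := leqP (N %/ y) 0.
  by rewrite big1 // => d _; move: h; rewrite leqn0 => /eqP ->; rewrite div0n.
apply: leq_trans (_ : \sum_(1 <= d < (N %/ y).+1) N %/ y %/ d <= _); last first.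
  apply: leq_trans (harmonic_sum _) _; rewrite leq_mul2l ltnS leq_trunc_log ?orbT //.
  exact: leq_div.
rewrite big_filter big_mkcond /=.
apply: leq_trans (_ : \sum_(1 <= d < N.+1) N %/ y %/ d <= _).
  by apply: leq_sum => d _; case: ifP.
have hN : N %/ y <= N by exact: leq_div.
rewrite (big_cat_nat (n := (N %/ y).+1)) //= [X in _ + X]big_nat.
rewrite [X in _ + X]big1 ?addn0 // => d /andP[hd _].
by rewrite divn_small.
Qed.

(** All alternatives but the first are rare once [T] and [y] are suitable powers of the
    logarithm. *)
Lemma exactly_perfect_cases k T y n : 0 < y -> exactly_perfect k n ->
  [\/ max_prime_extension k n, T <= tau n \/ (exists2 d, y < d & d * d %| n),
      tau n < T /\ (forall q, prime q -> q %| n -> q <= y) | determined k T y n].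
Proof.
move=> y0 Ek; have n0 : 0 < n by case: Ek.
have [hT|hT] := leqP T (tau n); first by constructor 2; left.
pose p := max_pdiv n.
have pmax q : prime q -> q %| n -> q <= p.
  by move=> pq qn; apply: max_pdiv_max; rewrite mem_primes pq n0.
have [py|py] := leqP p y.
  by constructor 3; split=> // q pq qn; apply: leq_trans (pmax q pq qn) py.
have n1 : 1 < n.
  rewrite ltn_neqAle n0 andbT; apply/eqP => e1; move: py; rewrite /p -e1 /max_pdiv.
  by rewrite (_ : last 1 (primes 1) = 1) // ltnS leqn0 => /eqP y00; rewrite y00 in y0.
have pp : prime p by exact: max_pdiv_prime.
have [p2|p2] := boolP (p * p %| n); first by constructor 2; right; exists p.
have pn : p %| n by exact: max_pdiv_dvd.
pose m := n %/ p; have en : n = m * p by rewrite /m divnK.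
have pm : ~~ (p %| m).
  by apply: contra p2 => pm; rewrite en dvdn_mul.
have m0 : 0 < m by case: (m) en n0 => // ->.
move: Ek; rewrite en => /(exactly_perfect_factor pp pm).
case=> D1 [D0 [[u1 s1] [u0 s0] sk e]].
have [eA|nA] := eqVneq (2 * m + \sum_(d <- D1) d) (sigma m).
  (* Equal coefficients of [p] leave [sigma m] as the sum of [D0], so [D0] contains every divisor of
     [m]. *)
  constructor 1; exists m, p, (size D1); split=> //; first by rewrite -en.
  split; first by apply/exactly_perfectP; split=> //; exists D1.
  rewrite -sk; congr addn; apply/esym; apply: sub_divisors_sum_sigma => //.
  by move: e; rewrite eA; lia.
constructor 4; exists m, p, D1, D0; split=> //.
- split=> //; apply: leq_ltn_trans hT.
  rewrite en tau_mul_prime //; have := tau_gt0 m; lia.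
- by split=> // d /s1 /andP[].
- by apply: decode_primeP => //; exact/eqP.
Qed.

Lemma sparse_not_extension k : sparse (fun n => exactly_perfect k n /\ ~ max_prime_extension k n).
Proof.
(* As [L < 2 ^ b <= 2 * L] for the [b] below, the thresholds [T] and [y] are powers of order [t] and
   [u] of the logarithm of [N]. The choice of [u] lets [y] outgrow the factor [(2 * T.+1) ^ k] of
   [cnt_determined]; the bound for smooth numbers is a power of 2 with exponent quadratic in [b],
   hence at most [L]. *)
move=> A; pose t := A + 3; pose u := (t + 2) * k + A + 3.
have ev := evt_comp_log (evt_log_sqr ((u + 2) * t + A + 2)).
apply: evt_sub (evt_and (evt_log 1) ev) => N; set L := trunc_log 2 N.
move=> [L0]; set b := (trunc_log 2 L).+1 => hb.
have N0 : 0 < N by rewrite lt0n; apply/eqP => e; move: L0; rewrite /L e trunc_log0.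
have Lb : L.+1 <= 2 ^ b by exact: trunc_log_ltn.
have NL : 2 ^ L <= N by exact: trunc_logP.
pose T := 2 ^ (b * t); pose y := 2 ^ (b * u).
have y0 : 0 < y by rewrite expn_gt0.
have T0 : 0 < T by rewrite expn_gt0.
have b0 : 0 < b by [].
pose P1 n := T <= tau n; pose P2 n := exists2 d, y < d & d * d %| n.
pose P3 n := tau n < T /\ (forall q, prime q -> q %| n -> q <= y).
pose P4 := determined k T y.
have hc : cnt (fun n => exactly_perfect k n /\ ~ max_prime_extension k n) N <=
    cnt P1 N + cnt P2 N + (cnt P3 N + cnt P4 N).
  apply: leq_trans (leq_add (cnt_or P1 P2 N) (cnt_or P3 P4 N)).
  apply: leq_trans (cnt_or _ _ N); apply: cnt_sub => n _ [Ek ng].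
  by case: (exactly_perfect_cases T y0 Ek) => //; [left | right; left | right; right].
(* Each of the four counts has to gain a factor [2 ^ e], which covers [L ^ A] and the 4 needed for
   adding them up. *)
have key c e : c * 2 ^ e <= N -> b * A + 2 <= e -> 4 * (c * L ^ A) <= N.
  move=> h1 h2; apply: leq_trans h1.
  apply: leq_trans (_ : c * 2 ^ (b * A + 2) <= _); last first.
    by rewrite leq_mul2l leq_exp2l // h2 orbT.
  rewrite expnD expnM -[2 ^ 2]/4 mulnCA leq_mul2l [leqRHS]mulnC leq_mul2l.
  apply/orP; right; case: (A) => [//|A']; rewrite leq_exp2r //; exact: ltnW.
have divy c : c <= N %/ y -> c * y <= N.
  by move=> h; apply: leq_trans (leq_mul h (leqnn y)) (leq_divM _ _).
have h1 : 4 * (cnt P1 N * L ^ A) <= N.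
  apply: (key _ (b * (A + 2))); last by nia.
  have := cnt_tau_ge T N; rewrite -/P1 -/L => h.
  have : cnt P1 N * 2 ^ (b * (A + 2)) * 2 ^ b <= N * 2 ^ b.
    rewrite -mulnA -expnD (_ : _ + b = b * t); last by rewrite /t; lia.
    rewrite mulnC -/T; apply: leq_trans h _; rewrite leq_mul2l Lb orbT //.
  by rewrite leq_pmul2r // expn_gt0.
have h2 : 4 * (cnt P2 N * L ^ A) <= N.
  apply: (key _ (b * (A + 2))); last by nia.
  have := cnt_square N y0; rewrite -/P2 -/L => h.
  have : cnt P2 N * 2 ^ (b * (A + 2)) * 2 ^ b <= N * 2 ^ b.
    rewrite -mulnA -expnD; apply: leq_trans (leq_mul h (leqnn _)) _.
    rewrite mulnAC leq_mul //; apply: leq_trans (leq_divM N y).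
    by rewrite leq_mul2l leq_exp2l // /u; apply/orP; right; nia.
  by rewrite leq_pmul2r // expn_gt0.
have h3 : 4 * (cnt P3 N * L ^ A) <= N.
  apply: (key _ (b * A + 2)); last by [].
  apply: leq_trans NL; apply: leq_trans (leq_mul (cnt_smooth (b * t) y N) (leqnn _)) _.
  rewrite -/L.
  apply: leq_trans (_ : (2 ^ (b * u + 1 + b)) ^ (b * t) * 2 ^ (b * A + 2) <= _).
    rewrite leq_mul2r; apply/orP; right.
    apply: (@leq_trans ((2 ^ (b * u + 1) * 2 ^ b) ^ (b * t))); last by rewrite -expnD.
    have bt : 0 < b * t by rewrite muln_gt0 /t addn_gt0 orbT.
    rewrite leq_exp2r // leq_mul // addn1 expnS -/y; lia.
  rewrite -expnM -expnD leq_exp2l //; apply: leq_trans hb.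
  rewrite expnS expn1 -/b; nia.
have h4 : 4 * (cnt P4 N * L ^ A) <= N.
  apply: (key _ (b * A + 2)); last by [].
  apply: leq_trans (leq_mul (cnt_determined k T N y0) (leqnn _)) _.
  apply: leq_trans (leq_divM N y); rewrite -mulnA leq_mul2l; apply/orP; right.
  apply: leq_trans (_ : (2 ^ (b * t + 2)) ^ k * 2 ^ (b * A + 2) <= _).
    rewrite leq_mul2r; apply/orP; right; case: (k) => // k'.
    by rewrite leq_exp2r // expnD -/T; lia.
  rewrite -expnM -expnD leq_exp2l // /u; nia.
apply: leq_trans (leq_mul hc (leqnn _)) _; rewrite !mulnDl; lia.
Qed.

(** * Members of [E(k)] with [sigma n] between [2 * n] and [2 * n + n^(1/3)] *)

Definition near_perfect n := 2 * n <= sigma n /\ (sigma n - 2 * n) ^ 3 < n.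

Definition perfect_prime k n := exists m p,
  [/\ perfect m, prime p, ~~ (p %| m), n = m * p & tau m = k].

(** If [n = m * p] and [m] has abundance [d > 0], that of [n] is at least [p * d], so
    [p * p * d ^ 3 < m]. Hence [p <= m], [m] is itself near perfect, and [sparse_mul] applies to the
    induction hypothesis. That [m] is no perfect number times a prime is also forced: [m = m2 * q]
    would give [q <= p] and [d = 2 * m2], making [m] too small. *)
Lemma sparse_near_perfect k :
  sparse (fun n => [/\ exactly_perfect k n, near_perfect n & ~ perfect_prime k n]).
Proof.
elim/ltn_ind: k => k IH.
pose Q j n := [/\ exactly_perfect j n, near_perfect n & ~ perfect_prime j n].
apply: sparse_sub (sparse_or (sparse_not_extension k)
  (sparse_mul (sparse_exists (k := k) (P := Q) IH))) => n n0 [Ek [n2 n3] npp].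
have [[m [p [j [pp pm en pmax [Ej ejk]]]]]|] := pselect (max_prime_extension k n); last by left.
right; have m0 : 0 < m by case: Ej.
have p0 := prime_gt0 pp.
have j0 : 0 < j.
  rewrite lt0n; apply/eqP => j0; apply: npp; exists m, p; split=> //.
    by apply/exactly_perfect0; rewrite -j0.
  by rewrite -ejk j0.
have dm := exactly_perfect_sigma Ej.
pose d := sigma m - 2 * m; have d0 : 0 < d by rewrite /d; lia.
have em : sigma m = 2 * m + d by rewrite /d; lia.
have dn : p * d <= sigma n - 2 * n.
  by rewrite en sigma_mul_prime // em; nia.
have c3 : (p * d) ^ 3 < m * p.
  by rewrite -en; apply: leq_ltn_trans n3; rewrite leq_exp2r.
have c2 : p * p * d ^ 3 < m by move: c3; rewrite !expnS !expn0; nia.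
have d3 : 0 < d ^ 3 by rewrite expn_gt0 d0.
exists m, p; split=> //; first by nia.
exists j; first by have := tau_gt0 m; lia.
split=> //; first by split; rewrite -/d; nia.
case=> m2 [q [[m20 e2] pq qm2 emq _]].
have qp : q <= p by apply: pmax; rewrite // en emq -mulnA dvdn_mull // dvdn_mulr.
have ed : d = 2 * m2 by rewrite /d emq sigma_mul_prime // e2 mulnS mulnA addnK.
have h1 : m2 <= d ^ 3.
  apply: leq_trans (leq_pexp2l d0 (isT : 1 <= 3)); rewrite expn1 ed; lia.
have := leq_mul (leq_trans qp (leq_pmulr p p0)) h1; rewrite emq in c2; lia.
Qed.

(** * Dickson's finiteness theorem for perfect numbers *)

Lemma pdiv_sigma_le m : 1 < m -> sigma m * pdiv m <= m * pdiv m + tau m * m.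
Proof.
move=> m1; have m0 : 0 < m by exact: ltnW.
have pd := perm_divisors_proper m0.
rewrite /tau (perm_size pd) /sigma (perm_big _ pd) big_cons mulnDl leq_add2l /=.
apply: leq_trans (_ : size (proper_divisors m) * m <= _); last by rewrite leq_mul2r leqnSn orbT.
rewrite big_distrl /= -sum1_size big_distrl /= big_seq [leqRHS]big_seq.
apply: leq_sum => d; rewrite mem_proper_divisors // => /andP[/dvdnP[c em] dm].
(* The cofactor [c] of a proper divisor is at least the smallest prime factor, so
   [d * pdiv m <= m]. *)
have c1 : 1 < c by nia.
have := pdiv_min_dvd c1 (_ : c %| m); rewrite {1}em dvdn_mulr // => /(_ isT).
rewrite mul1n {3}em mulnC => h; exact: leq_mul.
Qed.

(* Dickson's argument: if [m1] is the part of [m] on the smallest primes, then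
   [sigma m1 / m1 <= 2 - 1 / m1] bounds the next prime in terms of [m1] and [tau m]. *)
Lemma perfect_bounded k : exists B, forall m, perfect m -> tau m <= k -> m <= B.
Proof.
(* For [m1 <= M] the next prime power has [p <= 2 * k * M] and exponent at most [k], so [g M] bounds
   the enlarged [m1]. *)
pose g M := M * (2 * k * M) ^ k.
have key r : forall M m1 m2, 0 < m1 -> 0 < m2 -> coprime m1 m2 -> perfect (m1 * m2) ->
    size (primes m2) <= r -> tau m2 <= k -> m1 <= M -> m1 * m2 <= iter r g M.
  elim: r => [|r IH] M m1 m2 m10 m20 c12 pm sr tk mM.
    move: sr; rewrite leqn0 size_eq0 => /eqP e2.
    suff -> : m2 = 1 by rewrite muln1.
    by rewrite (prod_prime_decomp m20) prime_decompE e2 big_nil.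
  have k0 : 0 < k by apply: leq_trans tk; exact: tau_gt0.
  have M0 : 0 < M by exact: leq_trans mM.
  have gM i : M <= iter i g M.
    elim: i => //= i IHi; apply: leq_trans IHi _.
    have : 0 < iter i g M.
      by elim: i => //= i IHi; rewrite /g muln_gt0 IHi expn_gt0 !muln_gt0 IHi k0.
    by move=> h; rewrite /g leq_pmulr // expn_gt0 !muln_gt0 h k0.
  have [m21|m21] := leqP m2 1.
    have -> : m2 = 1 by lia.
    by rewrite muln1; apply: leq_trans mM _.
  have [_ epm] := pm; rewrite sigmaM // in epm.
  have pp := pdiv_prime m21.
  have [a [s [a0 s0 cs e2 _]]] := pfactor_split m20 pp (pdiv_dvd m2).
  (* Cancelling [m2] in [h6] leaves [2 * m1 * p <= (2 * m1 - 1) * (p + k)] for [p = pdiv m2]. *)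
  have pb : pdiv m2 <= 2 * k * m1.
    have h1 := pdiv_sigma_le m21; have h2 := sigma_gt m21.
    have h3 : sigma m1 < 2 * m1 by nia.
    have h4 : sigma m2 * pdiv m2 <= m2 * (pdiv m2 + k) by nia.
    have h5 : sigma m1 * (sigma m2 * pdiv m2) <= (2 * m1 - 1) * (m2 * (pdiv m2 + k)).
      by apply: leq_mul => //; lia.
    have h6 : m2 * (2 * m1 * pdiv m2) <= m2 * ((2 * m1 - 1) * (pdiv m2 + k)).
      have -> : m2 * (2 * m1 * pdiv m2) = sigma m1 * sigma m2 * pdiv m2 by rewrite epm; lia.
      by rewrite -[X in X <= _]mulnA [leqRHS]mulnCA.
    by move: h6; rewrite leq_pmul2l // => h6; nia.
  move: pb pp cs e2; move: (pdiv m2) => p pb pp cs e2.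
  have pa0 : 0 < p ^ a by rewrite expn_gt0 prime_gt0.
  have ak : a <= k.
    move: tk; rewrite e2 tauM // tau_pfactor //; have := tau_gt0 s; nia.
  have [c1a c1s] : coprime m1 (p ^ a) /\ coprime m1 s.
    by move: c12; rewrite e2 coprimeMr => /andP[].
  rewrite e2 mulnA iterSr; apply: IH => //.
  - by rewrite muln_gt0 m10.
  - by rewrite coprimeMl c1s cs.
  - by rewrite -mulnA -e2.
  - by move: sr; rewrite e2 size_primes_pfactorM.
  - by apply: leq_trans tk; rewrite e2 tauM // leq_pmull // tau_gt0.
  - apply: leq_mul => //; apply: leq_trans (_ : p ^ k <= _).
      by rewrite leq_exp2l // prime_gt1.
    by rewrite leq_exp2r // (leq_trans pb) // leq_mul2l mM orbT.
exists (iter k g 1) => m pm tk; have m0 : 0 < m by case: pm.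
rewrite -[m]mul1n; apply: key => //; rewrite ?coprime1n ?mul1n //.
apply: leq_trans tk; apply: leq_trans (tau_ge_expn_omega m0).
exact: ltnW (ltn_expl _ _).
Qed.

(** * Abundant numbers have at least six divisors *)

Lemma sigma_pfactor_lt p a : prime p -> sigma (p ^ a) < 2 * p ^ a.
Proof.
move=> pp; rewrite sigma_pfactor //; elim: a => [|a IH]; first by rewrite big_ord1.
rewrite big_ord_recr /= mul2n -addnn ltn_add2r; apply: leq_trans IH _.
by rewrite expnS leq_mul2r prime_gt1 ?orbT.
Qed.

(** With at most five divisors, [m] is a prime power, which is deficient, or a product of distinct
    primes [p] and [s]; there [(p + 1) * (s + 1) > 2 * p * s] would force [p = s = 2]. *)
Lemma abundant_tau m : 0 < m -> 2 * m < sigma m -> 5 < tau m.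
Proof.
move=> m0 ab; rewrite ltnNge; apply/negP => tm.
have [m1|m1] := leqP m 1.
  have := sigma_pfactor 0 (isT : prime 2); rewrite expn0 big_ord1.
  rewrite [2 ^ _]expn0 => e1; have em : m = 1 by lia.
  by move: ab; rewrite em e1.
have pp := pdiv_prime m1.
have [a [s [a0 s0 cs e sm]]] := pfactor_split m0 pp (pdiv_dvd m).
move: pp cs e; move: (pdiv m) => p pp cs e.
have pa0 : 0 < p ^ a by rewrite expn_gt0 prime_gt0.
have [s1|s1] := leqP s 1.
  have es : s = 1 by lia.
  by move: ab; rewrite e es muln1; have := sigma_pfactor_lt a pp; lia.
have p1s : 1 \in proper_divisors s by rewrite mem_proper_divisors ?dvd1n.
have ts : 1 < tau s.
  rewrite /tau (perm_size (perm_divisors_proper s0)) /= ltnS.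
  by case: (proper_divisors s) p1s.
move: tm ab; rewrite e tauM // tau_pfactor // sigmaM // => tm.
have ea : a = 1 by nia.
have t2 : tau s = 2 by nia.
have -> : sigma s = s + 1.
  rewrite /sigma (perm_big _ (perm_divisors_proper s0)) big_cons; congr addn.
  move: t2; rewrite /tau (perm_size (perm_divisors_proper s0)) /= => -[].
  by move: p1s; case: (proper_divisors s) => [|x [|y l]] //; rewrite inE big_seq1 => /eqP.
rewrite ea expn1 sigma_prime // => h.
have := prime_gt1 pp => p1; have [h1 h2] : p = 2 /\ s = 2 by nia.
by move: cs; rewrite ea h1 h2.
Qed.

(** * Chebyshev's bounds *)

Definition primepi := cnt (fun n => prime n).

Lemma central_bin_fact n : 'C(2 * n, n) * (n`! * n`!) = (2 * n)`!.
Proof.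
have -> : n`! * n`! = n`! * (2 * n - n)`! by congr (_ * _`!); lia.
by apply: bin_fact; lia.
Qed.

(** In Legendre's formula each power [p ^ k] contributes 0 or 1, and 0 once it exceeds [2 * n]. *)
Lemma logn_central_bin p n : prime p -> logn p 'C(2 * n, n) <= trunc_log p (2 * n).
Proof.
move=> pp; have p1 := prime_gt1 pp.
have := logn_fact (2 * n) pp; rewrite -central_bin_fact.
rewrite !lognM ?muln_gt0 ?fact_gt0 ?bin_gt0 //; try lia.
rewrite logn_fact // => e.
have ext : \sum_(1 <= k < n.+1) n %/ p ^ k = \sum_(1 <= k < (2 * n).+1) n %/ p ^ k.
  rewrite [RHS](big_cat_nat (n := n.+1)) //=; last by lia.
  rewrite [X in _ + X]big_nat [X in _ + X]big1 ?addn0 // => k /andP[nk _].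
  by rewrite divn_small // (ltn_trans _ (ltn_expl k p1)).
have h2 : \sum_(1 <= k < (2 * n).+1) (2 * n) %/ p ^ k <=
   \sum_(1 <= k < (2 * n).+1) (2 * (n %/ p ^ k) + (k <= trunc_log p (2 * n))).
  apply: leq_sum => k _; have q0 : 0 < p ^ k by rewrite expn_gt0 prime_gt0.
  have [h|h] := ltnP (2 * n) (p ^ k); first by rewrite divn_small.
  rewrite trunc_log_max // addn1 -ltnS ltn_divLR //.
  by have := ltn_ceil n q0; nia.
have h3 : \sum_(1 <= k < (2 * n).+1) (k <= trunc_log p (2 * n)) <= trunc_log p (2 * n).
  rewrite -big_mkcond /= sum1_count -size_filter -[leqRHS](size_iota 1).
  apply: uniq_leq_size; first by rewrite filter_uniq ?iota_uniq.
  by move=> k; rewrite mem_filter mem_iota mem_index_iota; lia.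
by move: e h2 h3; rewrite ext big_split /= -big_distrr /=; lia.
Qed.

(** Passing from [m] to [m.+1] multiplies the right-hand side by [2 * (2 * m + 1) / m], which
    exceeds 4. *)
Lemma central_bin_ge n : 0 < n -> 4 ^ n <= 2 * n * 'C(2 * n, n).
Proof.
case: n => // n _; elim: n => [|n IH]; first by [].
have e0 m : 'C((2 * m).+1, m.+1) = 'C((2 * m).+1, m).
  have h1 : m.+1 <= (2 * m).+1 by lia.
  have h2 : (2 * m).+1 - m.+1 = m by lia.
  by rewrite -(bin_sub h1) h2.
have e1 m : 'C(2 * m.+1, m.+1) = 2 * 'C((2 * m).+1, m).
  have -> : 2 * m.+1 = (2 * m).+2 by lia.
  by rewrite binS e0 [RHS]mul2n addnn.
have e2 m : m.+1 * 'C((2 * m).+1, m) = (2 * m).+1 * 'C(2 * m, m).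
  by rewrite mul_bin_diag e0.
set m := n.+1 in IH *.
rewrite expnS e1; have : 2 * m * (2 * m.+1 * (2 * 'C((2 * m).+1, m))) >= 2 * m * (4 * 4 ^ m).
  rewrite (_ : 2 * m.+1 * _ = 4 * (m.+1 * 'C((2 * m).+1, m))); last by lia.
  by rewrite e2; nia.
by rewrite leq_pmul2l.
Qed.

Lemma central_bin_le n : 'C(2 * n, n) <= 2 ^ (2 * n).
Proof.
suff h m k : 'C(m, k) <= 2 ^ m by [].
elim: m k => [|m IH] [|k] //; first by rewrite bin0 expn_gt0.
by rewrite binS expnS; have := IH k; have := IH k.+1; lia.
Qed.

(** Every prime power in the central binomial coefficient is at most [2 * n], so the coefficient is
    at most [2 * n] to the number of primes; it is at least [4 ^ n / (2 * n)]. *)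
Lemma chebyshev_lower N : N <= (trunc_log 2 N).+1 * (primepi N).+1 + 1.
Proof.
pose n := N./2; have hN : 2 * n <= N <= (2 * n).+1 by rewrite /n; lia.
have [n0|n0] := posnP n; first by lia.
set C := 'C(2 * n, n); have C0 : 0 < C by rewrite bin_gt0; lia.
have hp p : p \in primes C -> prime p /\ p <= 2 * n.
  rewrite -logn_gt0 => h; have pp : prime p by move: h; rewrite lognE; case: prime.
  split=> //; have := leq_trans h (logn_central_bin n pp).
  by rewrite trunc_log_gt0 prime_gt1 //=; have := prime_gt0 pp; lia.
have hs : size (primes C) <= primepi N.
  rewrite /primepi /cnt -size_filter; apply: uniq_leq_size; first exact: primes_uniq.
  move=> p /hp[pp hpn]; rewrite mem_filter asboolT //= mem_iota; have := prime_gt0 pp; lia.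
have hC : C <= (2 * n) ^ size (primes C).
  rewrite {1}(prod_prime_decomp C0) prime_decompE big_map /=.
  have : {in primes C, forall p, p ^ logn p C <= 2 * n}.
    move=> p /hp[pp _]; apply: leq_trans (trunc_logP (prime_gt1 pp) _); last by lia.
    by rewrite leq_exp2l ?prime_gt1 // logn_central_bin.
  elim: (primes C) => [|p s IH] h; first by rewrite big_nil.
  rewrite big_cons expnS leq_mul ?h ?mem_head // IH // => q qs; apply: h.
  by rewrite inE qs orbT.
have : 2 ^ (2 * n) <= 2 ^ ((trunc_log 2 N).+1 * (primepi N).+1).
  rewrite {1}expnM; apply: leq_trans (central_bin_ge n0) _; rewrite -/C.
  apply: leq_trans (_ : (2 * n) ^ (primepi N).+1 <= _).
    rewrite expnS leq_mul2l; apply/orP; right; apply: leq_trans hC _.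
    by rewrite leq_exp2l //; lia.
  rewrite expnM leq_exp2r //; have := trunc_log_ltn N (isT : 1 < 2); lia.
by rewrite leq_exp2l //; lia.
Qed.

Lemma prime_dvd_fact p n : prime p -> p %| n`! -> p <= n.
Proof.
move=> pp; elim: n => [|n IH]; first by rewrite fact0 Euclid_dvd1.
by rewrite factS Euclid_dvdM // => /orP[/dvdn_leq h|/IH]; [exact: h | exact: leqW].
Qed.

(** The primes between [n] and [2 * n] all divide the central binomial coefficient. *)
Lemma primepi_double n : 0 < n ->
  n ^ (primepi (2 * n) - primepi n) <= 2 ^ (2 * n).
Proof.
move=> n0; apply: leq_trans (central_bin_le n).
set C := 'C(2 * n, n); have C0 : 0 < C by rewrite bin_gt0; lia.
have -> : primepi (2 * n) - primepi n = count prime (iota n.+1 n).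
  rewrite /primepi /cnt mul2n -addnn iotaD count_cat add1n addKn.
  by apply: eq_count => p; rewrite asboolb.
rewrite -size_filter; set s := [seq p <- iota n.+1 n | prime p].
apply: leq_trans (_ : \prod_(p <- s) p <= _).
  have : all (fun p => n <= p) s.
    by apply/allP => p; rewrite mem_filter mem_iota; lia.
  elim: s => [|p s IH]; first by rewrite big_nil.
  by move=> /= /andP[h /IH h']; rewrite big_cons expnS leq_mul.
apply: dvdn_leq => //.
have : all (fun p => prime p && (p %| C)) s.
  apply/allP => p; rewrite mem_filter mem_iota => /andP[pp hp]; rewrite pp /=.
  have pf : p %| (2 * n)`! by rewrite dvdn_fact // prime_gt0 //=; lia.
  move: pf; rewrite -central_bin_fact !Euclid_dvdM // orbb => /orP[//|].
  by move=> /(prime_dvd_fact pp); lia.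
have : uniq s by rewrite filter_uniq ?iota_uniq.
elim: s => [|p s IH]; first by rewrite big_nil.
move=> /= /andP[ps us] /andP[/andP[pp pC] sC]; rewrite big_cons Gauss_dvd ?pC ?IH //.
rewrite prime_coprime //; apply: contra ps; rewrite Euclid_dvd_prod // big_has.
move=> /hasP[q qs]; have /allP/(_ q qs)/andP[pq _] := sC.
by rewrite dvdn_prime2 // => /eqP ->.
Qed.

Lemma primepi_even_le n : 0 < n -> primepi (2 * n) <= n.
Proof.
case: n => // n _; elim: n => [|n IH].
  by rewrite /primepi /cnt /= !asboolb.
rewrite (_ : 2 * n.+2 = 2 * n.+1 + 2); last by lia.
rewrite /primepi /cnt iotaD count_cat -/(cnt _ _) -/primepi /= !asboolb.
have -> : prime (1 + 2 * n.+1).+1 = false.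
  apply/negbTE/negP => /even_prime[]; lia.
by move: IH; case: prime; lia.
Qed.

(** Let [x = 2 ^ i]. Up to [x] the induction hypothesis gives [3 * x], the primes from [x] to
    [2 * x] add [2 * x], and raising [i] to [i.+1] costs [x] by [primepi_even_le]: in all
    [3 * (2 * x)]. *)
Lemma primepi_exp2 i : primepi (2 ^ i) * i <= 3 * 2 ^ i.
Proof.
elim: i => [|i IH]; first by rewrite muln0.
have p0 : 0 < 2 ^ i by rewrite expn_gt0.
have := primepi_double p0; rewrite -expnM leq_exp2l // => h.
have := primepi_even_le p0; rewrite -expnS in h *.
have := cnt_homo (fun n => prime n) (_ : 2 ^ i <= 2 ^ i.+1).
rewrite leq_exp2l // -/primepi => /(_ (leqnSn i)).
by move: h; rewrite [2 ^ i.+1]expnS; move: (2 ^ i) IH p0 => x; nia.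
Qed.

Lemma chebyshev_upper N : 0 < N -> primepi N * trunc_log 2 N <= 6 * N.
Proof.
move=> N0; set L := trunc_log 2 N.
have h1 : N <= 2 ^ L.+1 by exact/ltnW/trunc_log_ltn.
have h2 : 2 ^ L <= N by exact: trunc_logP.
apply: leq_trans (leq_mul (cnt_homo _ h1) (leqnSn L)) _.
by apply: leq_trans (primepi_exp2 L.+1) _; rewrite expnS; lia.
Qed.

(** * Divergence of the sum of the reciprocals of the primes *)

Lemma evt_smooth y :
  evt (fun N => 2 * cnt (fun n => forall q, prime q -> q %| n -> q <= y) N <= N).
Proof.
pose Y := y.+1.
apply: evt_sub (evt_and (evt_log 1) (evt_comp_log (evt_log_sqr ((Y + 1) * 3 + 2)))).
move=> N; set L := trunc_log 2 N => -[L0]; set b := (trunc_log 2 L).+1 => hb.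
have N0 : 0 < N by rewrite lt0n; apply/eqP => e; move: L0; rewrite /L e trunc_log0.
have Lb : L.+1 <= 2 ^ b by exact: trunc_log_ltn.
have NL : 2 ^ L <= N by exact: trunc_logP.
have b0 : 0 < b by [].
(* The threshold is at least [4 * L.+1], so at most a quarter of the integers reach it; smooth
   numbers below it are at most 2 to a power quadratic in [b]. *)
pose P1 n := 2 ^ (b + 2) <= tau n.
pose P2 n := tau n < 2 ^ (b + 2) /\ (forall q, prime q -> q %| n -> q <= y).
have h : cnt (fun n => forall q, prime q -> q %| n -> q <= y) N <= cnt P1 N + cnt P2 N.
  apply: leq_trans (cnt_or _ _ N); apply: cnt_sub => n _ hn.
  by have [h|h] := leqP (2 ^ (b + 2)) (tau n); [left | right].
have h1 : 4 * cnt P1 N <= N.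
  have : 2 ^ b * (4 * cnt P1 N) <= 2 ^ b * N; last by rewrite leq_pmul2l // expn_gt0.
  rewrite mulnA -(expnD 2 b 2); apply: leq_trans (cnt_tau_ge _ N) _.
  by rewrite mulnC leq_mul2r Lb orbT.
have h2 : 4 * cnt P2 N <= N.
  apply: leq_trans NL; apply: leq_trans (_ : 2 ^ (2 + (Y + b) * (b + 2)) <= _).
    rewrite expnD leq_mul2l; apply/orP; right; apply: leq_trans (cnt_smooth _ _ _) _.
    rewrite expnM leq_exp2r ?addn2 // expnD -/L leq_mul //.
    exact: ltnW (ltn_expl _ _).
  by rewrite leq_exp2l //; apply: leq_trans hb; rewrite -/b; nia.
lia.
Qed.

(* Every [n <= N] is [y]-smooth or divisible by a prime [p > y], and there are at most
   [N %/ p] such [n] for each [p]. *)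
Lemma prime_recip_block y : exists z, forall N, z <= N ->
  N <= 4 * \sum_(y.+1 <= p < z.+1 | prime p) N %/ p.
Proof.
case: (evt_smooth y) => X hX; pose z := maxn X 1; exists z => N zN.
have z0 : 0 < z by rewrite leq_max orbT.
have hz : z <= 2 * \sum_(y.+1 <= p < z.+1 | prime p) z %/ p.
  pose s := [seq p <- index_iota y.+1 z.+1 | prime p].
  have h2 : cnt (fun n => ~ forall q, prime q -> q %| n -> q <= y) z <=
      \sum_(y.+1 <= p < z.+1 | prime p) z %/ p.
    rewrite -big_filter -/s.
    apply: leq_trans (_ : \sum_(p <- s) cnt (fun n => p %| n) z <= _).
      apply: cnt_cover => n /andP[n0 nz] /existsNP[q] /not_implyP[pq] /not_implyP[qn] /negP.
      rewrite -ltnNge => yq; exists q => //; rewrite mem_filter pq mem_index_iota yq /=.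
      by rewrite ltnS (leq_trans (dvdn_leq n0 qn)).
    rewrite big_seq [leqRHS]big_seq; apply: leq_sum => p; rewrite mem_filter => /andP[pp _].
    exact/cnt_dvdn/prime_gt0.
  have h1 := hX z (leq_maxl _ _).
  have := cnt_or (fun n => forall q, prime q -> q %| n -> q <= y)
    (fun n => ~ forall q, prime q -> q %| n -> q <= y) z.
  have -> : cnt (fun n => (forall q, prime q -> q %| n -> q <= y) \/
     ~ forall q, prime q -> q %| n -> q <= y) z = z.
    rewrite -[RHS](size_iota 1 z) /cnt; apply/eqP; rewrite -all_count; apply/allP => n _.
    exact/asboolP/EM.
  lia.
(* The bound at [z] is scaled up to [N]; rounding [N / z] costs a second factor 2. *)
have h : N %/ z * \sum_(y.+1 <= p < z.+1 | prime p) z %/ p <=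
    \sum_(y.+1 <= p < z.+1 | prime p) N %/ p.
  rewrite big_distrr /=; apply: leq_sum => p pp; rewrite leq_divRL ?prime_gt0 // -mulnA.
  apply: leq_trans (leq_divM N z); rewrite leq_mul2l leq_divM orbT //.
have q0 : 0 < N %/ z by rewrite divn_gt0.
have := ltn_ceil N z0.
have := leq_mul (leqnn (N %/ z)) hz; rewrite mulnCA {hz}.
move: (\sum_(y.+1 <= p < z.+1 | prime p) N %/ p) h => a.
move: (\sum_(y.+1 <= p < z.+1 | prime p) z %/ p) (N %/ z) q0 => c q q0 h.
nia.
Qed.

(** Successive disjoint blocks of primes each contribute [N]. *)
Lemma prime_recip_diverge K y : exists2 z, y <= z & forall N, z <= N ->
  K * N <= 4 * \sum_(y.+1 <= p < z.+1 | prime p) N %/ p.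
Proof.
elim: K => [|K [z yz IH]]; first by exists y.
have [z' hz'] := prime_recip_block z; exists (maxn z z').
  by rewrite leq_max yz.
move=> N; rewrite geq_max => /andP[zN z'N].
rewrite mulSn addnC (big_cat_nat (n := z.+1)) //=; last by rewrite ltnS leq_maxl.
rewrite mulnDr leq_add ?IH //; apply: leq_trans (hz' N z'N) _; rewrite leq_mul2l /=.
have [h|h] := leqP z z'; first by [].
by rewrite big_geq // ltnS ltnW.
Qed.

(** * Seeds: numbers whose prime multiples lie in [E(k)] *)

Lemma sum_exp2_iota s n : \sum_(i <- iota s n) 2 ^ i = 2 ^ (s + n) - 2 ^ s.
Proof.
elim: n s => [|n IH] s; first by rewrite big_nil addn0 subnn.
rewrite /= big_cons IH addSnnS; have := leq_pexp2l (isT : 0 < 2) (leq_addr n s.+1).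
by rewrite addSnnS [2 ^ s.+1]expnS; lia.
Qed.

Lemma sum_pexp4_iota t : \sum_(i <- iota 1 t) 3 * 2 ^ (2 * i) = 2 ^ (2 * t + 2) - 4.
Proof.
elim: t => [|t IH]; first by rewrite big_nil.
rewrite -(addn1 t) iotaD big_cat /= big_seq1 IH (_ : 2 * (t + 1) + 2 = (2 * t + 2).+2); last by lia.
rewrite (_ : 2 * (1 + t) = 2 * t + 2); last by lia.
have : 2 ^ 2 <= 2 ^ (2 * t + 2) by rewrite leq_exp2l //; lia.
by rewrite !expnS; lia.
Qed.

Lemma coprime_3_exp2 a : coprime 3 (2 ^ a).
Proof. by case: a => // a; rewrite coprime_pexpr. Qed.

(* For [m = 3 * 2 ^ a] the abundance is [2 ^ (a + 1) - 4 = 4 + 8 + ... + 2 ^ a], and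
   replacing [4 ^ i + 2 * 4 ^ i] by [3 * 4 ^ i] for [1 <= i <= t] saves [t] summands. *)
Lemma exactly_perfect_3exp2 a t : 2 * t < a ->
  exactly_perfect (a - 1 - t) (3 * 2 ^ a).
Proof.
move=> ta; apply/exactly_perfectP.
have p0 : 0 < 2 ^ a by rewrite expn_gt0.
split; first by rewrite muln_gt0.
exists ([seq 3 * 2 ^ (2 * i) | i <- iota 1 t] ++
        [seq 2 ^ i | i <- iota (2 * t + 2) (a - 1 - 2 * t)]); split.
- rewrite cat_uniq !map_inj_uniq ?iota_uniq //=; last 2 first.
  + exact: expnI.
  + move=> i j /eqP; rewrite eqn_pmul2l // eqn_exp2l // => /eqP; lia.
  rewrite andbT; apply/hasPn => _ /mapP[i _ ->]; apply/negP => /mapP[j _ e].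
  have : 3 %| 2 ^ i by rewrite e dvdn_mulr.
  by rewrite Euclid_dvdX.
- move=> d; rewrite mem_cat => /orP[] /mapP[i]; rewrite mem_iota => hi ->.
    by rewrite dvdn_pmul2l // ltn_pmul2l // dvdn_exp2l ?ltn_exp2l //; lia.
  rewrite dvdn_mull ?dvdn_exp2l //=; last by lia.
  have : 2 ^ i <= 2 ^ a by rewrite leq_exp2l //; lia.
  lia.
- by rewrite size_cat !size_map !size_iota; lia.
- rewrite big_cat !big_map /= sum_pexp4_iota sum_exp2_iota.
  rewrite sigmaM ?coprime_3_exp2 // sigma_prime // sigma_pfactor //.
  have -> : \sum_(i < a.+1) 2 ^ i = 2 ^ a.+1 - 1 by rewrite [RHS]subn1 predn_exp mul1n.
  have -> : 2 * t + 2 + (a - 1 - 2 * t) = a.+1 by lia.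
  have : 2 ^ 2 <= 2 ^ (2 * t + 2) by rewrite leq_exp2l //; lia.
  have : 2 ^ (2 * t + 2) <= 2 ^ a.+1 by rewrite leq_exp2l //; lia.
  by rewrite [2 ^ a.+1]expnS; lia.
Qed.

(** By [exactly_perfect_mul_prime], such an [m] puts [m * p] in [E(k)] for every prime [p] not
    dividing [m]. *)
Definition seeded k := exists m j, exactly_perfect j m /\ j + tau m = k.

(** The seed [3 * 2 ^ a] has [2 * a.+1] divisors, so it serves [k = 3 * a + 1 - t]. Here [t] is 0, 1
    or 2 according to [k] modulo 3, and [16 <= k] gives [a >= 5 > 2 * t]. *)
Lemma seeded_large k : 16 <= k -> seeded k.
Proof.
move=> k16; pose a := k.+1 %/ 3; pose t := 3 * a + 1 - k.
exists (3 * 2 ^ a), (a - 1 - t); split; first by apply: exactly_perfect_3exp2; rewrite /t /a; lia.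
rewrite tauM ?coprime_3_exp2 ?expn_gt0 // tau_prime // tau_pfactor // /t /a; lia.
Qed.

Lemma exactly_perfect_dec n s D : 0 < n -> divisors n = s -> uniq D ->
  all (fun d => (d %| n) && (d < n)) D -> sumn s = 2 * n + sumn D ->
  exactly_perfect (size D) n.
Proof.
move=> n0 es uD /allP sD e; apply/exactly_perfectP; split=> //; exists D; split=> //.
by rewrite /sigma es !sumnE in e *.
Qed.

(** These are the values below 16 among those named in the theorem. *)
Lemma seeded_small k : k \in [:: 4; 6; 7; 8; 9; 12] -> seeded k.
Proof.
rewrite !inE => /or4P[/eqP->|/eqP->|/eqP->|/or3P[]/eqP->].
- by exists 6, 0; split=> //; apply: (@exactly_perfect_dec 6 _ [::]).
- by exists 28, 0; split=> //; apply: (@exactly_perfect_dec 28 _ [::]).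
- by exists 12, 1; split=> //; apply: (@exactly_perfect_dec 12 _ [:: 4]).
- by exists 12, 2; split=> //; apply: (@exactly_perfect_dec 12 _ [:: 1; 3]).
- by exists 24, 1; split=> //; apply: (@exactly_perfect_dec 24 _ [:: 12]).
- by exists 30, 4; split=> //; apply: (@exactly_perfect_dec 30 _ [:: 1; 2; 3; 6]).
Qed.

(** * Lower bounds for [E(k)], and the multiples of perfect numbers *)

Lemma cnt_mul_ge d (P Q : nat -> Prop) N : 0 < d ->
  (forall n, P n -> Q (d * n)) -> cnt P (N %/ d) <= cnt Q N.
Proof.
move=> d0 h; rewrite /cnt -!size_filter -(size_map (muln d)); apply: uniq_leq_size.
  rewrite map_inj_uniq ?filter_uniq ?iota_uniq // => x y /eqP.
  by rewrite eqn_pmul2l // => /eqP.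
move=> _ /mapP[n + ->]; rewrite !mem_filter !mem_iota => /andP[/asboolP Pn hn].
rewrite asboolT /=; last exact: h.
have : n <= N %/ d by lia.
by rewrite leq_divRL // mulnC; nia.
Qed.

Lemma cnt_bounded z N : cnt (fun n => n <= z) N <= z.
Proof.
rewrite /cnt -size_filter -[leqRHS](size_iota 1); apply: uniq_leq_size.
  by rewrite filter_uniq ?iota_uniq.
by move=> n; rewrite mem_filter !mem_iota => /andP[/asboolP]; lia.
Qed.

Lemma primepi_split z N : primepi N <= cnt (fun p => prime p /\ z < p) N + z.
Proof.
apply: leq_trans (leq_add (leqnn _) (cnt_bounded z N)); apply: leq_trans (cnt_or _ _ N).
by apply: cnt_sub => p _ pp; have [h|h] := leqP p z; [right | left].
Qed.

Lemma sum_const_seq (s : seq nat) c : \sum_(i <- s) c = size s * c.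
Proof. by rewrite big_const_seq count_predT iter_addn_0 mulnC. Qed.

(** Chebyshev's lower bound is applied to the primes above the seed [m], which cannot divide it. The
    positivity serves where the count is a denominator. *)
Lemma cnt_seeded k : seeded k ->
  exists C, evt (fun N => 0 < cnt (exactly_perfect k) N /\
    N <= C * trunc_log 2 N * cnt (exactly_perfect k) N).
Proof.
move=> [m [j [Em ek]]]; have m0 : 0 < m by case: Em.
exists (2 * (m * (m + 4))).
have [X hX] := evt_and (evt_log 1) (evt_log_sqr (m * (m + 4))).
exists (maxn X 1) => N; rewrite geq_max => /andP[/hX[L0 hs] N0].
set L := trunc_log 2 N in L0 hs *; set c := cnt _ N.
have h1 : primepi (N %/ m) <= c + m.
  apply: leq_trans (primepi_split m _) _; rewrite leq_add2r; apply: cnt_mul_ge => // p [pp mp].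
  by rewrite -ek; apply: exactly_perfect_mul_prime => //; apply/negP => /(dvdn_leq m0); lia.
have h2 := chebyshev_lower (N %/ m).
have h3 : trunc_log 2 (N %/ m) <= L by apply: leq_trunc_log; exact: leq_div.
have h4 : N < (N %/ m).+1 * m by exact: ltn_ceil.
have h5 : N %/ m <= L.+1 * (c + m).+1 + 1.
  by apply: leq_trans h2 _; rewrite leq_add2r leq_mul.
have h6 : N < (L.+1 * (c + m + 3)) * m.
  apply: leq_trans h4 _; rewrite leq_mul2r; apply/orP; right.
  by rewrite (_ : c + m + 3 = (c + m).+1 + 2) ?mulnDr; lia.
have c0 : 0 < c.
  rewrite lt0n; apply/negP => /eqP c0; move: h6; rewrite c0 add0n ltnNge => /negP; apply.
  apply: leq_trans hs; rewrite -mulnA; apply: leq_mul.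
    by rewrite expnS expn1 leq_pmulr.
  by rewrite mulnC leq_mul2l; lia.
split=> //; apply: leq_trans (ltnW h6) _.
apply: leq_trans (_ : (2 * L * ((m + 4) * c)) * m <= _); last by lia.
rewrite leq_mul2r; apply/orP; right; apply: leq_mul; first by lia.
by rewrite -addnA (_ : (m + 4) * c = c + (m + 3) * c) ?leq_add2l ?leq_pmulr //; lia.
Qed.

Lemma cnt_disjoint (s : seq nat) (Q : nat -> nat -> Prop) P N : uniq s ->
  {in s, forall i n, Q i n -> P n} ->
  {in s &, forall i j n, Q i n -> Q j n -> i = j} ->
  \sum_(i <- s) cnt (Q i) N <= cnt P N.
Proof.
move=> us hP hQ; rewrite cntE.
have -> : \sum_(i <- s) cnt (Q i) N = \sum_(i <- s) \sum_(1 <= n < N.+1) `[< Q i n >].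
  by apply: eq_bigr => i _; rewrite cntE.
rewrite exchange_big /=; apply: leq_sum => n _.
have [[i [is_ Qi]]|h] := pselect (exists i, i \in s /\ Q i n).
  rewrite (bigD1_seq i) //= (asboolT Qi) (asboolT (hP i is_ n Qi)) big_seq_cond big1 //.
  move=> j /andP[js ji]; rewrite asboolF // => Qj; move: ji.
  by rewrite (hQ i j is_ js n Qi Qj) eqxx.
rewrite big_seq big1 // => i is_; rewrite asboolF // => Qi; apply: h; by exists i.
Qed.

(** The numbers [m * p * q] with [m < p <= z < q] belong to this [E(k)] and determine [p]. Chebyshev
    gives order [N / (m * p * log N)] of them for each [p], and the sum of [1 / p] is as large as
    desired. *)
Lemma cnt_two_primes m j K : exactly_perfect j m ->
  evt (fun N => K * N <= trunc_log 2 N * cnt (exactly_perfect (j + tau m + 2 * tau m)) N).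
Proof.
move=> Em; have m0 : 0 < m by case: Em.
set k := j + tau m + 2 * tau m.
have [z mz hz] := prime_recip_diverge (32 * m * K.+1) m.
(* [c0] collects the losses: at most [z.+1] primes [p], each losing the [q <= z] and the constants
   of Chebyshev's bound. *)
pose c0 := z.+1 * (z + 2).
have [X hX] := evt_and (evt_log 1) (evt_log_sqr c0).
exists (maxn X (maxn (z.+1 * m) 1)) => N; rewrite !geq_max => /and3P[/hX[L0 hs] zN N0].
set L := trunc_log 2 N in L0 hs *; set c := cnt _ N.
pose s := [seq p <- index_iota m.+1 z.+1 | prime p].
have ps p : p \in s -> [/\ prime p, m < p & p <= z].
  by rewrite mem_filter mem_index_iota => /andP[pp /andP[h1 h2]].
have us : uniq s by rewrite filter_uniq ?iota_uniq.
have ss : size s <= z.+1.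
  by rewrite size_filter (leq_trans (count_size _ _)) // size_iota; lia.
have h1 : \sum_(p <- s) cnt (fun n => exists q, [/\ prime q, z < q & n = m * p * q]) N <= c.
  apply: cnt_disjoint => //.
    move=> p /ps[pp mp pz] _ [q [pq zq ->]].
    have pm : ~~ (p %| m) by apply/negP => /(dvdn_leq m0); lia.
    rewrite /k -(tau_mul_prime m0 pp pm); apply: exactly_perfect_mul_prime => //.
      exact: exactly_perfect_mul_prime.
    rewrite Euclid_dvdM // negb_or; apply/andP; split; apply/negP => /dvdn_leq; [lia|].
    by have := prime_gt0 pp; lia.
  move=> p p' /ps[pp mp pz] /ps[pp' mp' pz'] n [q [pq zq ->]] [q' [pq' zq' /eqP]].
  rewrite -!mulnA eqn_pmul2l // => /eqP e.
  have : p %| p' * q' by rewrite -e dvdn_mulr.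
  rewrite Euclid_dvdM // !dvdn_prime2 // => /orP[/eqP //|/eqP]; lia.
have h2 : \sum_(p <- s) N %/ m %/ p <= L.+1 * (c + c0).
  apply: leq_trans (_ : \sum_(p <- s) L.+1 *
     (cnt (fun n => exists q, [/\ prime q, z < q & n = m * p * q]) N + (z + 2)) <= _).
    rewrite big_seq [leqRHS]big_seq; apply: leq_sum => p /ps[pp mp pz].
    have mp0 : 0 < m * p by rewrite muln_gt0 m0 prime_gt0.
    rewrite -divnMA; set M := N %/ (m * p).
    apply: leq_trans (chebyshev_lower M) _.
    have hL : trunc_log 2 M <= L by apply: leq_trunc_log; exact: leq_div.
    have : primepi M <= cnt (fun n => exists q, [/\ prime q, z < q & n = m * p * q]) N + z.
      apply: leq_trans (primepi_split z _) _; rewrite leq_add2r; apply: cnt_mul_ge => //.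
      by move=> q [pq zq]; exists q.
    move: (cnt _ N) => d hd; apply: leq_trans (_ : L.+1 * (d + z).+1 + L.+1 <= _).
      by apply: leq_add => //; apply: leq_mul.
    by rewrite -mulnSr leq_mul2l /=; lia.
  rewrite -big_distrr /= leq_mul2l /= big_split /= leq_add //.
  by rewrite sum_const_seq /c0 leq_mul.
have zNm : z <= N %/ m by rewrite leq_divRL //; nia.
have := hz _ zNm; rewrite -big_filter -/s => h3.
have h4 : N <= 2 * m * (N %/ m).
  have q0 : 0 < N %/ m by rewrite divn_gt0 //; apply: leq_trans zN; exact: leq_pmull.
  apply: leq_trans (ltnW (ltn_ceil N m0)) _.
  by rewrite mulnC [2 * m]mulnC -mulnA leq_mul2l; lia.
have h5 : 32 * m * K.+1 * (N %/ m) <= 8 * L * (c + c0).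
  apply: leq_trans h3 _; apply: leq_trans (leq_mul (leqnn 4) h2) _.
  by rewrite mulnA leq_mul2r; apply/orP; right; lia.
have h6 : 16 * K.+1 * N <= 8 * L * (c + c0).
  apply: leq_trans h5; apply: leq_trans (leq_mul (leqnn _) h4) _; lia.
have h7 : L * c0 <= N.
  by apply: leq_trans hs; rewrite leq_mul2r expnS expn1; apply/orP; right; nia.
lia.
Qed.

(** Starting from the perfect number 28, each new prime doubles [tau] and adds its old value to [j].
    For [r = s - 3] this gives [j + 3 * tau m = 3 * 2 ^ s - 6]. *)
Lemma exactly_perfect_28_chain r : exists2 m, exactly_perfect (6 * (2 ^ r - 1)) m & tau m = 6 * 2 ^ r.
Proof.
elim: r => [|r [m Em tm]].
  by exists 28 => //; apply: (@exactly_perfect_dec 28 _ [::]).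
have m0 : 0 < m by case: Em.
have [p mp pp] := prime_above m.
have pm : ~~ (p %| m) by apply/negP => /(dvdn_leq m0); lia.
exists (m * p); last by rewrite tau_mul_prime // tm expnS; lia.
have := exactly_perfect_mul_prime Em pp pm.
by rewrite tm (_ : _ + _ = 6 * (2 ^ r.+1 - 1)) // expnS; have := expn_gt0 2 r; lia.
Qed.

(** Dickson's theorem leaves finitely many [m], and each yields at most [primepi N] multiples. *)
Lemma cnt_perfect_prime k : exists B, forall N, 0 < N ->
  cnt (perfect_prime k) N * trunc_log 2 N <= B * N.
Proof.
have [B hB] := perfect_bounded k; exists (B.+1 * 6) => N N0.
have h : cnt (perfect_prime k) N <= B.+1 * primepi N.
  apply: leq_trans (_ : \sum_(m <- iota 1 B.+1)
      cnt (fun n => exists2 p, n = p * m & prime p) N <= _).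
    apply: cnt_cover => n _ [m [p [Pm pp pm -> tm]]].
    have m0 : 0 < m by case: Pm.
    exists m; last by exists p => //; rewrite mulnC.
    by rewrite mem_iota m0 /=; have := hB m Pm; rewrite tm => /(_ (leqnn k)); lia.
  rewrite -[B.+1 in leqRHS](size_iota 1) -sum_const_seq big_seq [leqRHS]big_seq.
  apply: leq_sum => m; rewrite mem_iota => /andP[m0 _].
  apply: leq_trans (cnt_mul _ _ m0) _; apply: cnt_homo; exact: leq_div.
have := chebyshev_upper N0; move: h; move: (primepi N) (trunc_log 2 N) => a b h h'.
by rewrite -mulnA; nia.
Qed.

(** * Subsets of relative density zero in [E(k)] *)

Definition negligible_in k (P : nat -> Prop) := forall K,
  evt (fun N => K * cnt P N <= cnt (exactly_perfect k) N).

Lemma sparse_bounded Z : sparse (fun n => n <= Z).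
Proof.
move=> A; apply: evt_sub (evt_and (evt_log 1) (evt_comp_log (evt_log_sqr (Z + A)))).
move=> N; set L := trunc_log 2 N => -[L0]; set b := (trunc_log 2 L).+1 => hb.
have N0 : 0 < N by rewrite lt0n; apply/eqP => e; move: L0; rewrite /L e trunc_log0.
have Lb : L <= 2 ^ b by apply/ltnW; exact: trunc_log_ltn.
apply: leq_trans (trunc_logP (isT : 1 < 2) N0).
apply: leq_trans (_ : 2 ^ (Z + b * A) <= _); last first.
  by rewrite leq_exp2l //; apply: leq_trans hb; rewrite -/b; nia.
rewrite expnD expnM; apply: leq_mul.
  by apply: leq_trans (cnt_bounded Z N) _; exact: ltnW (ltn_expl _ _).
by case: (A) => // A'; rewrite leq_exp2r.
Qed.

(** With exponent 2, one logarithm matches the lower bound of order [N / log N] for [E(k)] and the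
    other outgrows [C * K]. *)
Lemma sparse_negligible k P : seeded k -> sparse P -> negligible_in k P.
Proof.
move=> /cnt_seeded[C hC] /(_ 2) hP K.
apply: evt_sub (evt_and (evt_log (C * K + 1)) (evt_and hC hP)) => N.
set L := trunc_log 2 N; move: (cnt P N) (cnt _ N) => a c [L0 [[c0 h1] h2]].
have h3 : a * L <= C * c.
  have : a * L * L <= C * c * L; last by rewrite leq_pmul2r //; lia.
  by move: (leq_trans h2 h1); rewrite expnS expn1; lia.
have [C0|C0] := posnP C.
  have a0 : a = 0 by move: h3; rewrite C0 mul0n leqn0 muln_eq0; lia.
  by rewrite a0 muln0.
rewrite -(leq_pmul2l C0); apply: leq_trans h3.
by rewrite mulnA mulnC leq_mul2l; apply/orP; right; lia.
Qed.

Lemma negligible_in_sub k (P Q : nat -> Prop) :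
  (forall n, 0 < n -> P n -> Q n) -> negligible_in k Q -> negligible_in k P.
Proof.
move=> h hQ K; apply: evt_sub (hQ K) => N; apply: leq_trans.
by rewrite leq_mul2l cnt_sub ?orbT // => n /andP[n0 _]; exact: h.
Qed.

Lemma negligible_in_or k P Q : negligible_in k P -> negligible_in k Q ->
  negligible_in k (fun n => P n \/ Q n).
Proof.
move=> hP hQ K; apply: evt_sub (evt_and (hP (2 * K)) (hQ (2 * K))) => N [h1 h2].
apply: leq_trans (leq_mul (leqnn K) (cnt_or P Q N)) _; lia.
Qed.

Lemma negligible_in_near k : seeded k -> negligible_in k (perfect_prime k) ->
  negligible_in k (fun n => exactly_perfect k n /\ near_perfect n).
Proof.
move=> sk hpp.
apply: negligible_in_sub (negligible_in_or (sparse_negligible sk (sparse_near_perfect k)) hpp).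
by move=> n _ [Ek nn]; have [h|h] := pselect (perfect_prime k n); [right | left].
Qed.

Lemma negligible_in_perfect_prime_none k : seeded k ->
  (forall m, perfect m -> tau m <> k) -> negligible_in k (perfect_prime k).
Proof.
move=> sk h; apply: negligible_in_sub (sparse_negligible sk (sparse_bounded 0)).
by move=> n _ [m [p [Pm _ _ _ tm]]]; case: (h m Pm tm).
Qed.

(** A fixed multiple of [N / log N] is set against a lower bound by every multiple of it. *)
Lemma negligible_in_perfect_prime_dominated m j k : exactly_perfect j m ->
  k = j + tau m + 2 * tau m -> negligible_in k (perfect_prime k).
Proof.
move=> Em -> K; set k' := _ + _ + _; have [B hB] := cnt_perfect_prime k'.
have [X hX] := evt_and (evt_log 1) (cnt_two_primes (K * B) Em).
exists (maxn X 1) => N; rewrite geq_max => /andP[/hX[L0 h] N0].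
have := hB N N0; move: h L0; rewrite -/k'.
move: (cnt _ N) (cnt _ N) (trunc_log 2 N) => c a L h L0 h2.
rewrite -(leq_pmul2l L0); apply: leq_trans h; rewrite mulnCA -mulnA leq_mul2l.
by rewrite mulnC h2 orbT.
Qed.

(** An odd perfect number has [tau m] equal to 2 modulo 4; an even one has [tau m = 2 * q] with [q]
    prime, divisible by 4 only for [q = 2]. *)
Lemma perfect_tau_mod4 k m : odd k \/ 4 %| k /\ k <> 4 -> perfect m -> tau m <> k.
Proof.
move=> hk Pm tm; have [om|om] := boolP (odd m).
  by have := odd_perfect_tau om Pm; rewrite tm; case: hk => [|[]]; lia.
have [q [pq _]] := even_perfect_tau om Pm; rewrite tm => ek.
case: hk => [|[]]; first by rewrite ek; lia.
rewrite ek => h4; have : 2 %| q by lia.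
by rewrite dvdn_prime2 // => /eqP <-.
Qed.

(** * From counts to limits of the ratio *)

Lemma card_fset_set_cnt (P : nat -> Prop) (A : set nat) N :
  (forall n, A n <-> 0 < n <= N /\ P n) -> #|` fset_set A| = cnt P N.
Proof.
move=> h; pose s := [seq n <- iota 1 N | `[< P n >]].
have -> : A = [set` seq_fset tt s]%classic.
  apply/funext => n; apply/propext.
  have -> : [set` seq_fset tt s]%classic n = (n \in s).
    by rewrite -[LHS]/(is_true (n \in seq_fset tt s)) seq_fsetE.
  rewrite h mem_filter mem_iota add1n ltnS; split=> [[nN Pn]|/andP[/asboolP Pn nN]] //.
  by rewrite asboolT.
rewrite set_fsetK size_seq_fset undup_id ?size_filter //.
by rewrite filter_uniq ?iota_uniq.
Qed.

Lemma cnt_split P Q N :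
  cnt P N = cnt (fun n => P n /\ Q n) N + cnt (fun n => P n /\ ~ Q n) N.
Proof.
rewrite !cntE -big_split /=; apply: eq_bigr => n _.
have [p|p] := pselect (P n); last by rewrite !asboolF // => -[].
have [q|q] := pselect (Q n).
  by rewrite (asboolT p) (asboolT (conj p q)) asboolF // => -[].
by rewrite (asboolT p) (asboolT (conj p q)) asboolF // => -[].
Qed.

Local Open Scope classical_set_scope.
Local Open Scope ring_scope.

Definition far_from_perfect (R : realType) (eps : R) (n : nat) : Prop :=
  (sigma n)%:R >= 2 * n%:R + n%:R `^ eps.

Lemma E_ratioE (R : realType) (eps : R) k (x : R) : 0 <= x ->
  E_ratio eps k x =
  (cnt (fun n => exactly_perfect k n /\ far_from_perfect eps n) (Num.truncn x))%:R /
  (cnt (exactly_perfect k) (Num.truncn x))%:R.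
Proof.
move=> x0; congr (_%:R / _%:R); apply: card_fset_set_cnt => n.
  split=> [[nx Ek fn]|[/andP[n0 nx] [Ek fn]]].
    by rewrite truncn_ge_nat // nx; case: (Ek) => ->.
  by split=> //; rewrite -truncn_ge_nat.
split=> [[Ek [n0 nx]]|[/andP[n0 nx] Ek]].
  by rewrite truncn_ge_nat // nx n0.
by split=> //; split=> //; rewrite -truncn_ge_nat.
Qed.

Lemma evt_pinfty (R : realType) (P : nat -> Prop) : evt P ->
  \forall x \near (+oo : set_system R), 0 <= x /\ P (Num.truncn x).
Proof.
move=> [X hX]; near=> x; have Xx : X%:R <= x by near: x; exact: nbhs_pinfty_ge.
have x0 : 0 <= x by apply: le_trans Xx.
by split=> //; apply: hX; rewrite truncn_ge_nat.
Unshelve. all: by end_near. Qed.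

Lemma small_ratio (R : realType) (e : R) (K a c : nat) : 0 < e -> e^-1 <= K%:R ->
  (0 < c)%N -> (K * a <= c)%N -> a%:R / c%:R <= e.
Proof.
move=> e0 eK c0 h; rewrite ler_pdivrMr ?ltr0n // -ler_pdivrMl //.
apply: le_trans (_ : (K * a)%:R <= _); last by rewrite ler_nat.
by rewrite natrM ler_wpM2r.
Qed.

Lemma E_ratio_cvg1 (R : realType) (eps : R) k : seeded k ->
  negligible_in k (fun n => exactly_perfect k n /\ ~ far_from_perfect eps n) ->
  E_ratio eps k x @[x --> +oo] --> (1 : R).
Proof.
move=> /cnt_seeded[C hC] hn; apply/cvgrPdist_le => e e0.
pose K := (Num.truncn e^-1).+1.
have eK : e^-1 <= K%:R.
  by have /truncn_itv/andP[_ /ltW] : 0 <= e^-1 by rewrite invr_ge0 ltW.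
apply: filterS (evt_pinfty R (evt_and hC (hn K))) => x [x0 [[c0 _] h]].
rewrite E_ratioE //; move: c0 h; rewrite (cnt_split _ (far_from_perfect eps)).
move: (cnt _ _) (cnt _ _) => b a c0 h.
have -> : 1 - a%:R / (a + b)%:R = b%:R / (a + b)%:R :> R.
  have ab0 : (a + b)%:R != 0 :> R by rewrite pnatr_eq0 -lt0n.
  by rewrite -[X in X - _](divff ab0) -mulrBl natrD addrC addKr.
by rewrite ger0_norm ?divr_ge0 ?ler0n //; apply: small_ratio h.
Qed.

Lemma E_ratio_cvg0 (R : realType) (eps : R) k : seeded k ->
  negligible_in k (fun n => exactly_perfect k n /\ far_from_perfect eps n) ->
  E_ratio eps k x @[x --> +oo] --> (0 : R).
Proof.
move=> /cnt_seeded[C hC] hn; apply/cvgrPdist_le => e e0.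
pose K := (Num.truncn e^-1).+1.
have eK : e^-1 <= K%:R.
  by have /truncn_itv/andP[_ /ltW] : 0 <= e^-1 by rewrite invr_ge0 ltW.
apply: filterS (evt_pinfty R (evt_and hC (hn K))) => x [x0 [[c0 _] h]].
rewrite E_ratioE // sub0r normrN ger0_norm ?divr_ge0 ?ler0n //.
exact: small_ratio h.
Qed.

(** The cube of [n^eps] is at most [n], because [3 * eps < 1] and [n >= 1]. *)
Lemma not_far_near_perfect (R : realType) (eps : R) k n : eps < 1 / 3 -> (0 < n)%N ->
  exactly_perfect k n -> ~ far_from_perfect eps n -> near_perfect n.
Proof.
move=> e3 n0 Ek /negP; rewrite -ltNge => h.
have s2 : (2 * n <= sigma n)%N.
  by apply: leq_trans (exactly_perfect_sigma Ek); exact: leq_addr.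
split=> //; rewrite -(ltr_nat R) natrX natrB // natrM.
have h1 : (sigma n)%:R - 2 * n%:R < n%:R `^ eps :> R by rewrite ltrBlDl.
have h0 : 0 <= (sigma n)%:R - 2 * n%:R :> R by rewrite subr_ge0 -natrM ler_nat.
apply: (@lt_le_trans _ _ ((n%:R `^ eps) ^+ 3)).
  by rewrite ltr_pXn2r // nnegrE ?powR_ge0.
rewrite -powR_mulrn ?powR_ge0 // -powRrM -[leRHS]powRr1 ?ler0n //.
apply: ler_powR; first by rewrite ler1n.
by rewrite ltW // -ltr_pdivlMr.
Qed.

(** Off a sparse set [n = m * p] with [j + tau m = k]. If [j > 0], then [m] is abundant and
    [tau m >= 6] gives [k > 6]. So [m] is perfect and bounded, the abundance of [n] is [2 * m], and
    [n^eps <= 2 * m] bounds [n]. *)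
Lemma negligible_in_far (R : realType) (eps : R) k : 0 < eps -> (k <= 6)%N -> seeded k ->
  negligible_in k (fun n => exactly_perfect k n /\ far_from_perfect eps n).
Proof.
move=> e0 k6 sk; have [B hB] := perfect_bounded k.
pose Z := Num.truncn ((2 * B)%:R `^ eps^-1 : R).
apply: negligible_in_sub (sparse_negligible sk (sparse_or (sparse_not_extension k) (sparse_bounded Z))).
move=> n n0 [Ek fn].
have [[m [p [j [pp pm en _ [Ej ej]]]]]|] := pselect (max_prime_extension k n); last by left.
right; have m0 : (0 < m)%N by case: Ej.
have j0 : j = 0%N.
  apply/eqP; rewrite -leqn0 leqNgt; apply/negP => j0.
  have := exactly_perfect_sigma Ej => hs.
  have : (5 < tau m)%N by apply: abundant_tau => //; lia.
  lia.
have Pm : perfect m by apply/exactly_perfect0; rewrite -j0.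
have mB : (m <= B)%N by apply: hB => //; lia.
move: fn; rewrite /far_from_perfect en sigma_mul_prime // -en.
have -> : (sigma m * p.+1)%N = (2 * n + 2 * m)%N by case: Pm => _ ->; rewrite en; lia.
rewrite natrD natrM lerD2l => h.
rewrite truncn_ge_nat ?powR_ge0 //.
have -> : n%:R = (n%:R `^ eps) `^ eps^-1 :> R.
  by rewrite -powRrM divff ?gt_eqF // powRr1.
apply: ge0_ler_powR; rewrite ?nnegrE ?powR_ge0 ?ler0n ?invr_ge0 //; first exact: ltW.
by apply: le_trans h _; rewrite ler_nat leq_mul2l mB.
Qed.

Theorem theorem1p9 (R : realType) (eps : R)
    (eps_gt0 : 0 < eps) (eps_lt13 : eps < 1 / 3) :
  [/\ ((forall n : nat, odd n -> ~ perfect n) ->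
       exists K : nat, forall k : nat, (K <= k)%N -> ~ M k ->
         E_ratio eps k x @[x --> +oo] --> (1 : R)),
      (forall k : nat,
         [\/ k = 8%N,
             (exists s : nat, (2 <= s <= 8)%N /\ k = (2 ^ (s + 2) - 4)%N),
             (exists s : nat, (2 <= s <= 8)%N /\ k = (3 * 2 ^ s - 5)%N) |
             (exists s : nat, (3 <= s <= 8)%N /\ k = (3 * 2 ^ s - 6)%N) \/
             (exists s : nat, (2 <= s <= 8)%N /\ k = (2 ^ (s + 2) - 7)%N)] ->
         E_ratio eps k x @[x --> +oo] --> (1 : R)) &
      (forall k : nat, k = 4%N \/ k = 6%N ->
         E_ratio eps k x @[x --> +oo] --> (0 : R))].
Proof.
have cvg1 k : seeded k -> negligible_in k (perfect_prime k) ->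
    E_ratio eps k x @[x --> +oo] --> (1 : R).
  move=> sk hk; apply: E_ratio_cvg1 => //; apply: negligible_in_sub (negligible_in_near sk hk).
  by move=> n n0 [Ek fn]; split=> //; exact: (not_far_near_perfect eps_lt13 n0 Ek fn).
have cvg1_mod4 k : seeded k -> odd k \/ (4 %| k)%N /\ k <> 4%N ->
    E_ratio eps k x @[x --> +oo] --> (1 : R).
  move=> sk hk; apply: cvg1 => //; apply: negligible_in_perfect_prime_none => // m.
  exact: perfect_tau_mod4.
(* Writing [2 ^ s] as [4 * x] exposes [k] modulo 4 to linear arithmetic; [x = 1] is the case of the
   small seeds. *)
have exp2 s : (2 <= s)%N -> exists2 x, (0 < x)%N & (2 ^ s = 4 * x)%N.
  move=> s2; exists (2 ^ (s - 2))%N; first by rewrite expn_gt0.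
  by rewrite -[4%N]/(2 ^ 2)%N -expnD subnKC.
split.
- move=> noodd; exists 16%N => k k16 nM; apply: cvg1; first exact: seeded_large.
  apply: negligible_in_perfect_prime_none; first exact: seeded_large.
  move=> m Pm tm; have [om|om] := boolP (odd m); first exact: noodd Pm.
  by have [q [pq pM tq]] := even_perfect_tau om Pm; apply: nM; exists q; rewrite -tq.
- move=> k [->|[s [/andP[s2 _] ->]]|[s [/andP[s2 _] ->]]|[[s [/andP[s3 _] ->]]|[s [/andP[s2 _] ->]]]].
  + by apply: cvg1_mod4; [exact: seeded_small | right].
  + have [x x0 e] := exp2 s s2; rewrite expnD e; apply: cvg1_mod4; last by right; lia.
    have [h|h] := leqP x 1; last by apply: seeded_large; lia.
    have x1 : x = 1%N by lia.
    by rewrite x1; exact: seeded_small.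
  + have [x x0 e] := exp2 s s2; rewrite e; apply: cvg1_mod4; last by left; lia.
    have [h|h] := leqP x 1; last by apply: seeded_large; lia.
    have x1 : x = 1%N by lia.
    by rewrite x1; exact: seeded_small.
  (* Here [k] is 2 modulo 4, so the residue does not exclude a perfect [m] with [tau m = k]; the
     products with two primes outnumber its multiples instead. *)
  + have es : (2 ^ s = 8 * 2 ^ (s - 3))%N by rewrite -[8%N]/(2 ^ 3)%N -expnD subnKC.
    have := expn_gt0 2 (s - 3) => /= p0.
    have [m Em tm] := exactly_perfect_28_chain (s - 3).
    apply: cvg1; first by apply: seeded_large; lia.
    by apply: (negligible_in_perfect_prime_dominated Em); rewrite tm; lia.
  + have [x x0 e] := exp2 s s2; rewrite expnD e; apply: cvg1_mod4; last by left; lia.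
    have [h|h] := leqP x 1; last by apply: seeded_large; lia.
    have x1 : x = 1%N by lia.
    by rewrite x1; exact: seeded_small.
- move=> k hk; have sk : seeded k by case: hk => ->; exact: seeded_small.
  by apply: E_ratio_cvg0 => //; apply: negligible_in_far => //; case: hk => ->.
Qed.
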